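(* For each $n\ge1$, the $\mathcal G$-graded center $Z^{\mathcal G}(H^n)$ of the unified arc algebra $H^n$ is isomorphic to the ring $R=\mathbb Z[X,Y,Z^{\pm1}]/(X^2=Y^2=1)$; thus the group $Z^{\mathcal G}_*(H^n)$ of invertible elements of the center is the group of units of $R$.
   Context: $R=\mathbb Z[X,Y,Z^{\pm1}]/(X^2=Y^2=1)$, $\lambda((a,b),(c,d))=X^{ac}Y^{bd}Z^{ad-bc}$ for $(a,b),(c,d)\in\mathbb Z^2$. A chronological cobordism between closed planar $1$-manifolds is a collared cobordism in $\mathbb R^2\times[0,1]$ whose height function is Morse with at most one critical point per level, with a framing (orientation of the unstable manifold of each critical point of index $1,2$, drawn as an arrow on the arc of a saddle). Its degree is $|W|=(\#\text{births}-\#\text{merges},\#\text{deaths}-\#\text{splits})\in\mathbb Z^2$. A change of chronology $H:W\Rightarrow W'$ is a diffeotopy through generic families of framed Morse functions; it is locally vertical if it is the identity outside finitely many vertical cylinders. To each change of chronology is associated $\iota(H)\in R^\times$, multiplicative under both compositions and given on exchanges of two saddles by: $X$ for two merges (on four distinct circles or three circles in a chain) and for two circles joined by two oppositely oriented arcs; $Y$ for two splits (of distinct circles or along two non-interleaved chords of one circle) and for two circles joined by two equally oriented arcs; $Z$ when a merge followed by a split is turned into a split followed by a merge (and $Z^{-1}$ in reverse); and for one circle with an upward-oriented inner chord and an outer arc with interleaved endpoints, $1$ if the outer arc is oriented from the right endpoint to the left endpoint, $XY$ if from left to right. The chronological TQFT $\mathcal F$: $V=Rv_+\oplus Rv_-$,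 $\deg v_+=(1,0)$, $\deg v_-=(0,-1)$; $\mathcal F$ of $k$ circles is $V^{\otimes k}$; merge: $v_+\otimes v_+\mapsto v_+$, $v_+\otimes v_-\mapsto v_-$, $v_-\otimes v_+\mapsto XZ\,v_-$, $v_-\otimes v_-\mapsto0$; split: $v_+\mapsto v_-\otimes v_++YZ\,v_+\otimes v_-$, $v_-\mapsto v_-\otimes v_-$ (for one of the framings; the opposite framing multiplies a merge by $X$ and a split by $Y$); factors are permuted by $x\otimes y\mapsto\lambda(|x|,|y|)\,y\otimes x$ and $(\mathrm{id}\otimes g)(x\otimes y)=\lambda(|g|,|x|)\,x\otimes g(y)$, $(f\otimes\mathrm{id})(x\otimes y)=f(x)\otimes y$. $B_m^n$ is the set of isotopy classes of flat tangles from $2m$ to $2n$ points, $B^n=B^n_0$ the set of crossingless matchings of $2n$ points, $\bar a$ the reflection of $a$, $1_n$ the identity tangle. For $a\in B^m,b\in B^n,c\in B^p$, $t\in B_m^n$, $s\in B_n^p$, $W_{abc}(t,s):(\bar c\circ s\circ b)\circ(\bar b\circ t\circ a)\to\bar c\circ s\circ t\circ a$ is the minimal cobordism contracting symmetric arcs of $b\circ\bar b$ by $n$ saddles, performed from right to left and framed upward; $s_{abc}(t,s)=|W_{abc}(t,s)|$. The unified arc algebra is $H^n=\bigoplus_{a,b\in B^n}\mathcal F(\bar b\circ a)$, with product $\mathcal F(\bar b\circ a)\otimes\mathcal F(\bar c\circ b')\to\mathcal F(\bar c\circ a)$ equal to $\mathcal F(W_{abc}(1_n,1_n))$ if $b'=b$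 and $0$ otherwise, tensor factors and framings being normalized so that $H^1=V$ with $\mu(v_+,v_+)=v_+$, $\mu(v_+,v_-)=v_-$, $\mu(v_-,v_+)=XZ\,v_-$, $\mu(v_-,v_-)=0$. The category $\mathcal G$: objects are all crossingless matchings $a\in\bigsqcup_m B^m$; $\mathrm{Hom}_{\mathcal G}(a,b)=B_m^n\times\mathbb Z^2$ for $a\in B^m$, $b\in B^n$; $(s,q)\circ(t,p)=(s\circ t,p+q+s_{abc}(t,s))$; $\mathrm{Id}_a=(1_m,(m,0))$ for $a\in B^m$. The associator is $\alpha((t_1,p_1),(t_2,p_2),(t_3,p_3))=\iota(H_\alpha)\,\lambda(s_{bcd}(t_2,t_3),p_1)$ for $a\xrightarrow{(t_1,p_1)}b\xrightarrow{(t_2,p_2)}c\xrightarrow{(t_3,p_3)}d$, where $H_\alpha$ is the locally vertical change of chronology $W_{acd}(t_2t_1,t_3)\circ(\mathbb 1\otimes W_{abc}(t_1,t_2))\Rightarrow W_{abd}(t_1,t_3t_2)\circ(W_{bcd}(t_2,t_3)\otimes\mathbb 1)$ ($\mathbb 1$ denoting identity cobordisms). An element of $\mathcal F(\bar b\circ a)\subset H^n$ of $\mathbb Z^2$-degree $p$ has $\mathcal G$-degree $(1_n,p):a\to b$. $H^n$ is a $\mathcal G$-graded (quasi-associative) algebra whose units are $e_a=v_+^{\otimes n}\in\mathcal F(\bar a\circ a)$ for $a\in B^n$; put $1=\sum_{a\in B^n}e_a$. The $\mathcal G$-graded center is $$Z^{\mathcal G}(H^n)=\Big\{z\in\bigoplus_{a\in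 B^n}(H^n)_{\mathrm{Id}_a}:\ \mu(x,z)=\zeta(|x|)\,\mu(z,x)\ \text{for all homogeneous }x\in H^n\Big\},$$ where for $g:a\to b$, $\zeta(g)=\alpha(\mathrm{Id}_a,\mathrm{Id}_a,g)\,\alpha(g,\mathrm{Id}_b,\mathrm{Id}_b)$, and $Z^{\mathcal G}_*(H^n)=\{z\in Z^{\mathcal G}(H^n):\exists z'\in Z^{\mathcal G}(H^n),\ \mu(z,z')=1\}$. *)

(* Defs.v *)
From HB Require Import structures.
From mathcomp Require Import all_boot all_order all_algebra.
From mathcomp Require Import zify mpoly boolp.

Set Implicit Arguments.
Unset Strict Implicit.
Unset Printing Implicit Defensive.

Import GRing.Theory.
Local Open Scope ring_scope.
Local Open Scope quotient_scope.

(** R = Z[X, Y, Z^{+-1}] / (X^2 = Y^2 = 1) is the quotient of Z[X, Y, Z, W] by the ideal generated by X^2 - 1,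
    Y^2 - 1 and ZW - 1; W becomes Z^{-1}. *)

Definition P4 : comNzRingType := {mpoly int[4]}.

Definition pX : P4 := 'X_(inord 0).
Definition pY : P4 := 'X_(inord 1).
Definition pZ : P4 := 'X_(inord 2).
Definition pW : P4 := 'X_(inord 3).

Definition rel_ideal : {pred P4} := fun p => `[< exists q1 q2 q3 : P4,
  p = q1 * (pX ^+ 2 - 1) + q2 * (pY ^+ 2 - 1) + q3 * (pZ * pW - 1) >].

Lemma rel_ideal_closed : idealr_closed rel_ideal.
Proof.
split.
- by apply/asboolP; exists 0, 0, 0; rewrite !mul0r !addr0.
- apply/negP => /asboolP [q1 [q2 [q3 E]]].
  have := congr1 (meval (fun=> 1)) E.
  by rewrite !(rmorphD, rmorphM, rmorphN, rmorphXn, rmorph1) /= !mevalXU !mulr1 subrr !mulr0 !addr0.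
- move=> a u v /asboolP [q1 [q2 [q3 ->]]] /asboolP [r1 [r2 [r3 ->]]].
  apply/asboolP; exists (a * q1 + r1), (a * q2 + r2), (a * q3 + r3).
  move: (_ - 1) (_ - 1) (_ - 1) => A1 A2 A3.
  by rewrite !mulrDr !mulrDl !mulrA addrACA [X in X + _ = _]addrACA.
Qed.

HB.instance Definition _ := isIdealr.Build P4 rel_ideal rel_ideal_closed.

Definition R : Type := {ideal_quot rel_ideal}.
HB.instance Definition _ := GRing.ComNzRing.on R.

Definition gX : R := \pi_{ideal_quot rel_ideal} pX.
Definition gY : R := \pi_{ideal_quot rel_ideal} pY.
Definition gZ : R := \pi_{ideal_quot rel_ideal} pZ.
Definition gZinv : R := \pi_{ideal_quot rel_ideal} pW.

Definition R_unit (r : R) : Prop := exists s : R, r * s = 1.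

Definition Zpow (k : int) : R :=
  match k with Posz m => gZ ^+ m | Negz m => gZinv ^+ m.+1 end.

Definition bideg : Type := (int * int)%type.

(** Absolute values are harmless in the exponents of X and Y, which have
    order 2. *)
Definition lam (p q : bideg) : R :=
  gX ^+ `|(p.1 * q.1)%R|%N * gY ^+ `|(p.2 * q.2)%R|%N * Zpow (p.1 * q.2 - p.2 * q.1).

(** A fixed-point free involution on points placed along a line (at [pos])
    without two crossing arcs. *)
Definition crossingless (T : finType) (pos : T -> nat) (f : {ffun T -> T}) :=
  [forall x, (f x != x) && (f (f x) == x)] &&
  [forall x, forall y,
     ~~ [&& (pos x < pos y)%N, (pos y < pos (f x))%N & (pos (f x) < pos (f y))%N]].

(** B^n: points are numbered from left to right.  The reflection of [a] is the
    same involution, drawn on the other side of the line. *)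
Definition B (n : nat) : Type :=
  {f : {ffun 'I_n.*2 -> 'I_n.*2} | crossingless (@nat_of_ord _) f}.
HB.instance Definition _ n := Finite.on (B n).

(** The endpoints of a flat tangle from 2m points at the bottom ([inl]) to 2n
    points at the top ([inr]), both numbered from left to right. *)
Definition strip (m n : nat) : Type := ('I_m.*2 + 'I_n.*2)%type.
HB.instance Definition _ m n := Finite.on (strip m n).

(** Counterclockwise position along the boundary of the strip. *)
Definition strip_pos m n (x : strip m n) : nat :=
  match x with inl i => i | inr j => (m.*2 + (n.*2 - j.+1))%N end.

(** B_m^n; an isotopy class of flat tangles without closed components is
    determined by the way it connects its endpoints, and B^n = B_0^n. *)
Definition flat (m n : nat) : Type :=
  {f : {ffun strip m n -> strip m n} | crossingless (@strip_pos m n) f}.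

Definition id_strip n : {ffun strip n n -> strip n n} :=
  [ffun x : strip n n => match x with inl i => inr i | inr i => inl i end].

Lemma id_stripP n : crossingless (@strip_pos n n) (id_strip n).
Proof.
apply/andP; split.
  by apply/forallP => -[] i; rewrite !ffunE /= eqxx.
apply/forallP => x; apply/forallP => y; apply/negP => /and3P [].
case: x => i; case: y => j; rewrite !ffunE /= => h1 h2 h3.
all: by have := ltn_ord i; have := ltn_ord j; lia.
Qed.

Definition id_flat n : flat n n := exist _ (id_strip n) (id_stripP n).

(** A closed planar 1-manifold is presented by a graph on a finite set [T] of
    points; its circles are the connected components of the graph.  A saddle
    is placed between two facing symmetric arcs: a lower one (a cap), joining
    [low_l] to [low_r], and an upper one (a cup), joining [up_l] to [up_r].
    Its framing points upwards, from the lower arc to the upper arc.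
    Performing it replaces the two arcs by the vertical segments [low_l]-[up_l]
    and [low_r]-[up_r], to the left and to the right of the arrow. *)

Record saddle (T : Type) := Saddle { low_l : T; low_r : T; up_l : T; up_r : T }.

Definition link (T : eqType) (p q x y : T) : bool :=
  (x == p) && (y == q) || (x == q) && (y == p).

Definition push (U T : finType) (f : U -> T) (g : U -> U) : rel T :=
  fun x y => [exists u, (x == f u) && (y == f (g u))].

Section Chronology.
Variables (T : finType) (e0 : rel T).

(** The manifold with fixed part [e0], after the saddles in [done] have been
    performed and those in [pending] have not. *)
Definition curve (done pending : seq (saddle T)) : rel T := fun x y =>
  [|| e0 x y,
      has (fun s => link (low_l s) (up_l s) x y || link (low_r s) (up_r s) x y) done
    | has (fun s => link (low_l s) (low_r s) x y || link (up_l s) (up_r s) x y) pending].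

Definition is_merge (done : seq (saddle T)) (s : saddle T) (pending : seq (saddle T)) :=
  ~~ connect (curve done (s :: pending)) (low_l s) (up_l s).

Fixpoint chron_deg (done todo : seq (saddle T)) : bideg :=
  if todo is s :: rest then
    let d := chron_deg (s :: done) rest in
    if is_merge done s rest then (d.1 - 1, d.2) else (d.1, d.2 - 1)
  else (0, 0).

(** iota of the change of chronology turning "[x], then [y]" into
    "[y], then [x]".  In the last case [x] and [y] are chords with interleaved
    endpoints of one circle, on different sides of it.  Seen from an upward
    inner chord, the value is 1 iff the tail of the outer arc is on the right;
    in terms of the circle oriented with the inner chord to its left, the feet
    are then in the cyclic order tail, tail, head, head of alternately the
    inner and the outer arc.  Reversing the orientation shows that this
    condition is symmetric in the two arcs, so that it can be read off with
    [x] as the upward chord whether [x] is inner or not: the tail of [y] is on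
    the circle to the right of [x] once [x] has been performed. *)
Definition iota_exchange (done : seq (saddle T)) (x y : saddle T)
    (pending : seq (saddle T)) : R :=
  let x_merges := is_merge done x (y :: pending) in
  let y_merges := is_merge done y (x :: pending) in
  let y_merges_after_x := is_merge (x :: done) y pending in
  match x_merges, y_merges_after_x with
  | true, true => gX
  | false, false => gY
  | true, false =>
      if y_merges then
        if connect (curve done [:: x, y & pending]) (low_l x) (low_l y)
        then gY else gX
      else gZ
  | false, true =>
      if y_merges then gZinv
      else if connect (curve (x :: done) (y :: pending)) (low_r x) (low_l y)
      then 1 else gX * gY
  end.

(** iota of the change of chronology turning [bs ++ [:: c]] into [c :: bs]. *)
Fixpoint iota_past (done bs : seq (saddle T)) (c : saddle T)
    (pending : seq (saddle T)) : R :=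
  if bs is b :: bs' then
    iota_exchange done b c (bs' ++ pending) * iota_past (b :: done) bs' c pending
  else 1.

(** iota of the change of chronology turning [bs ++ cs] into [cs ++ bs]. *)
Fixpoint iota_swap (done bs cs : seq (saddle T)) : R :=
  if cs is c :: cs' then
    iota_past done bs c cs' * iota_swap (c :: done) bs cs'
  else 1.

End Chronology.

(** F of a manifold has the basis of all labellings of its circles by v_+
    ([false]) and v_- ([true]), given as functions on points that are constant
    on circles.  The circles are ordered by the first of their points in a
    given enumeration [o] of the points; in this order such a labelling stands
    for a pure tensor in V^{(x) k}. *)

Definition labelling (T : finType) (e : rel T) (v : {ffun T -> bool}) : bool :=
  [forall x, forall y, e x y ==> (v x == v y)].

Fixpoint circles (T : finType) (e : rel T) (o : seq T) : seq T :=
  if o is x :: o' then x :: [seq y <- circles e o' | ~~ connect e x y] else [::].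

Definition vdeg (b : bool) : bideg := if b then (0, -1) else (1, 0).

(** The coefficient of the permutation of tensor factors from the order of
    circles [l] to the order [l'] (both lists contain one point of each
    circle). *)
Fixpoint reorder (T : finType) (e : rel T) (v : {ffun T -> bool}) (l l' : seq T) : R :=
  if l is x :: l1 then
    (\prod_(y <- l1 | (find (connect e y) l' < find (connect e x) l')%N)
        lam (vdeg (v x)) (vdeg (v y))) * reorder e v l1 l'
  else 1.

(** The coefficient of z in the merge of x (x) y, for a framing pointing from
    the first circle to the second. *)
Definition merge_coef (x y z : bool) : R :=
  match x, y, z with
  | false, false, false => 1
  | false, true, true => 1
  | true, false, true => gX * gZ
  | _, _, _ => 0
  end.

(** The coefficient of y (x) z in the split of x; the first factor is the
    circle to the left of the arrow.  (The other choice multiplies every split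
    by Y, in accordance with the permutation of the two factors.) *)
Definition split_coef (x y z : bool) : R :=
  match x, y, z with
  | false, true, false => 1
  | false, false, true => gY * gZ
  | true, true, true => 1
  | _, _, _ => 0
  end.

Section TQFT.
Variables (T : finType) (o : seq T) (e0 : rel T).

(** The matrix coefficient of F(saddle): bring the circles involved to the
    front, apply the merge or the split to the first factors, and restore the
    standard order. *)
Definition saddle_coef (done : seq (saddle T)) (s : saddle T) (pending : seq (saddle T))
    (v v' : {ffun T -> bool}) : R :=
  let e := curve e0 done (s :: pending) in
  let e' := curve e0 (s :: done) pending in
  let x := low_l s in
  let l := [seq z <- circles e o | ~~ connect e x z && ~~ connect e (up_l s) z] in
  if [&& labelling e v, labelling e' v'
       & [forall z, (~~ connect e x z && ~~ connect e (up_l s) z) ==> (v z == v' z)]] then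
    if is_merge e0 done s pending then
      reorder e v (circles e o) [:: x, up_l s & l]
      * merge_coef (v x) (v (up_l s)) (v' x)
      * reorder e' v' (x :: l) (circles e' o)
    else
      reorder e v (circles e o) (x :: l)
      * split_coef (v x) (v' x) (v' (low_r s))
      * reorder e' v' [:: x, low_r s & l] (circles e' o)
  else 0.

Fixpoint F_chron (done todo : seq (saddle T))
    (phi : {ffun {ffun T -> bool} -> R}) : {ffun {ffun T -> bool} -> R} :=
  if todo is s :: rest then
    F_chron (s :: done) rest
      [ffun v' => \sum_v phi v * saddle_coef done s rest v v']
  else phi.

End TQFT.

(** The closed manifold "b-bar t a". *)
Definition closure1 m n (a : B m) (b : B n) (t : flat m n) : rel (strip m n) :=
  fun x y =>
    [|| push inl (val a) x y, push id (val t) x y | push inr (val b) x y].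

(** The points of "(c-bar s b)(b-bar t a)" and of
    "(d-bar t3 c)(c-bar t2 b)(b-bar t1 a)". *)
Definition strip2 m n p : Type := (strip m n + strip n p)%type.
HB.instance Definition _ m n p := Finite.on (strip2 m n p).
Definition strip3 m n p q : Type := (strip m n + (strip n p + strip p q))%type.
HB.instance Definition _ m n p q := Finite.on (strip3 m n p q).

(** The saddles contracting "b b-bar", from right to left (an arc is located
    by its right endpoint, so that outer arcs come before the arcs they
    enclose); [lo] and [hi] are the lines carrying b-bar and b. *)
Definition contract (T : Type) n (b : B n) (lo hi : 'I_n.*2 -> T) : seq (saddle T) :=
  [seq Saddle (lo (val b j)) (lo j) (hi (val b j)) (hi j)
     | j <- rev (enum 'I_n.*2) & (val b j < j)%N].

Section W.
Variables (m n p : nat) (a : B m) (b : B n) (c : B p) (t : flat m n) (s : flat n p).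

Definition W_fixed : rel (strip2 m n p) := fun x y =>
  [|| push (fun i => inl (inl i)) (val a) x y,
      push inl (val t) x y,
      push inr (val s) x y
    | push (fun i => inr (inr i)) (val c) x y].

Definition W_saddles : seq (saddle (strip2 m n p)) :=
  contract b (fun i => inl (inr i)) (fun i => inr (inl i)).

Definition W_deg : bideg := chron_deg W_fixed [::] W_saddles.

End W.

(** Hom_G(a, b) = B_m^n x Z^2 does not depend on [a] and [b]; they are recorded
    because the associator does. *)
Definition HomG m n (a : B m) (b : B n) : Type := (flat m n * bideg)%type.

Definition IdG m (a : B m) : HomG a a := (id_flat m, (m%:Z, 0)).

Section Associator.
Variables (m n p q : nat) (a : B m) (b : B n) (c : B p) (d : B q).

Definition H_fixed (t1 : flat m n) (t2 : flat n p) (t3 : flat p q) :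
    rel (strip3 m n p q) := fun x y =>
  [|| push (fun i => inl (inl i)) (val a) x y,
      push inl (val t1) x y,
      push (fun u => inr (inl u)) (val t2) x y,
      push (fun u => inr (inr u)) (val t3) x y
    | push (fun i => inr (inr (inr i))) (val d) x y].

(** H_alpha turns "contract b, then c" into "contract c, then b". *)
Definition iota_H (t1 : flat m n) (t2 : flat n p) (t3 : flat p q) : R :=
  iota_swap (H_fixed t1 t2 t3) [::]
    (contract b (fun i => inl (inr i)) (fun i => inr (inl (inl i))))
    (contract c (fun i => inr (inl (inr i))) (fun i => inr (inr (inl i)))).

Definition alpha (g1 : HomG a b) (g2 : HomG b c) (g3 : HomG c d) : R :=
  iota_H g1.1 g2.1 g3.1 * lam (W_deg b c d g2.1 g3.1) g1.2.

End Associator.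

Definition zeta m n (a : B m) (b : B n) (g : HomG a b) : R :=
  alpha (IdG a) (IdG a) g * alpha g (IdG b) (IdG b).

(** Circles are ordered from right to left (by their rightmost points), like
    the saddles in [contract]: this is the normalization for which the
    elements [e_ a] are units of H^n. *)
Definition strip_enum m n : seq (strip m n) :=
  [seq inr j | j <- rev (enum 'I_n.*2)] ++ [seq inl i | i <- rev (enum 'I_m.*2)].

Definition strip2_enum m n p : seq (strip2 m n p) :=
  [seq inl u | u <- strip_enum m n] ++ [seq inr u | u <- strip_enum n p].

(** The standard basis of H^n: a summand F(b-bar a), with a = [src], b = [tgt],
    and a labelling of the circles of "b-bar a" (presented as "b-bar 1_n a"). *)
Definition gen (n : nat) : Type :=
  {g : B n * B n * {ffun strip n n -> bool}
     | labelling (closure1 g.1.1 g.1.2 (id_flat n)) g.2}.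

Definition src n (u : gen n) : B n := (val u).1.1.
Definition tgt n (u : gen n) : B n := (val u).1.2.
Definition lab n (u : gen n) : {ffun strip n n -> bool} := (val u).2.

Definition gen_deg n (u : gen n) : bideg :=
  let l := circles (closure1 (src u) (tgt u) (id_flat n)) (strip_enum n n) in
  ((count (fun x => ~~ lab u x) l)%:Z, - (count (lab u) l)%:Z).

Definition H (n : nat) : Type := {ffun gen n -> R^o}.

(** The labelling of "(c-bar b)(b-bar a)" formed by labellings of its two parts,
    and the transport of a labelling from "c-bar a" to "c-bar 1_n 1_n a".  The
    circles of "b-bar a" come first in [strip2_enum], so that the first one is
    the pure tensor in F(b-bar a) (x) F(c-bar b). *)
Definition glue n (v w : {ffun strip n n -> bool}) : {ffun strip2 n n n -> bool} :=
  [ffun x : strip2 n n n => match x with inl u => v u | inr u => w u end].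
Definition double n (v : {ffun strip n n -> bool}) : {ffun strip2 n n n -> bool} :=
  [ffun x : strip2 n n n => match x with inl u | inr u => v u end].

Definition mul_coef n (u v w : gen n) : R :=
  if [&& tgt u == src v, src w == src u & tgt w == tgt v] then
    F_chron (strip2_enum n n n)
      (W_fixed (src u) (tgt v) (id_flat n) (id_flat n)) [::]
      (W_saddles n n (tgt u))
      [ffun z => (z == glue (lab u) (lab v))%:R]
      (double (lab w))
  else 0.

Definition arc_mul n (x y : H n) : H n :=
  [ffun w => \sum_u \sum_v (x u : R) * (y v : R) * mul_coef u v w].

Definition e_ n (a : B n) : H n :=
  [ffun u => ([&& src u == a, tgt u == a & lab u == [ffun=> false]])%:R].

Definition arc_one n : H n := \sum_(a : B n) e_ a.

(** [x] belongs to the component of H^n of G-degree [g] : a -> b. *)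
Definition homogeneous n (a b : B n) (g : HomG a b) (x : H n) : Prop :=
  forall u : gen n, x u <> 0 ->
    [/\ src u = a, tgt u = b & g = (id_flat n, gen_deg u)].

Definition graded_center n (z : H n) : Prop :=
  (exists2 f : B n -> H n,
     (forall a, homogeneous (IdG a) (f a)) & z = \sum_(a : B n) f a) /\
  (forall (a b : B n) (g : HomG a b) (x : H n),
     homogeneous g x -> arc_mul x z = zeta g *: arc_mul z x).

Definition graded_center_inv n (z : H n) : Prop :=
  graded_center z /\ exists2 z' : H n, graded_center z' & arc_mul z z' = arc_one n.

(* Main.v *)
Require Import Defs.
From HB Require Import structures.
From mathcomp Require Import all_boot all_order all_algebra.
From mathcomp Require Import zify.
Import GRing.Theory.
Local Open Scope ring_scope.

(** An element of degree Id_a is supported on the labelling of all n circles of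
    "a-bar a" by v_+, so a candidate for the center is z = sum_a c_a e_a.  In the
    products e_a x and x e_b every saddle is a merge with a circle labelled v_+.
    Following the permutation coefficients through these n merges one finds
    e_a x = x and x e_b = kappa x with kappa = (X lam(|x|, (1, 0)))^n, a unit.
    On the other side both changes of chronology in zeta(|x|) exchange merges
    n^2 times and contribute X^(n^2) each, and W_abc has degree (-n, 0), whence
    zeta(|x|) = kappa as well.  Thus z is central iff c_a = c_b as soon as some
    nonzero x goes from a to b, which is the case for all a and b. *)

Set Implicit Arguments.
Unset Strict Implicit.
Unset Printing Implicit Defensive.

(** * The ring R *)

(** A circle labelled v_+ merges without changing any other label, so throughout the n saddles of
    e_a x and x e_b the state is a scalar times one basis labelling, and only the scalar has to be
    followed. It depends on the order of the circles, which makes the two products differ. In x e_b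
    the circles of e_b come last: transposing each of them with all of x gives lam(|x|, (1, 0)), and
    X appears because v_+ is the second argument of the merge. In e_a x they come first: a circle of
    x jumps ahead of the remaining circles of e_a at its first merge, and each of these later jumps
    ahead of it, at the inverse cost. To follow the order, each stage has an explicit function
    sending a point to the first point of its circle. The changes of chronology need no such
    function, since only the types of the saddles matter there: a two-valued function separating the
    two ends of a saddle shows that it is a merge. *)

Lemma gX2 : gX * gX = 1 :> R.
Proof.
rewrite /gX -rmorphM /= -(rmorph1 (\pi_{ideal_quot rel_ideal}%qT)).
apply/eqP; rewrite -Quotient.idealrBE.
by apply/boolp.asboolP; exists 1, 0, 0; rewrite !mul0r !addr0 mul1r expr2.
Qed.

Lemma gY2 : gY * gY = 1 :> R.
Proof.
rewrite /gY -rmorphM /= -(rmorph1 (\pi_{ideal_quot rel_ideal}%qT)).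
apply/eqP; rewrite -Quotient.idealrBE.
by apply/boolp.asboolP; exists 0, 1, 0; rewrite !mul0r addr0 add0r mul1r expr2.
Qed.

Lemma gZV : gZ * gZinv = 1 :> R.
Proof.
rewrite /gZ /gZinv -rmorphM /= -(rmorph1 (\pi_{ideal_quot rel_ideal}%qT)).
apply/eqP; rewrite -Quotient.idealrBE.
by apply/boolp.asboolP; exists 0, 0, 1; rewrite !mul0r !add0r mul1r.
Qed.

(** Locked so that simplification does not unfold [lam] into integer exponents inside long
    products. *)
HB.lock Definition vlam (x y : bool) : R := lam (vdeg x) (vdeg y).

Lemma vlam_pf x : vlam x false = if x then gZ else gX.
Proof. by case: x; rewrite vlam.unlock /lam /= ?expr0 ?expr1 ?mulr1 ?mul1r. Qed.

Lemma vlamC x y : vlam x y * vlam y x = 1.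
Proof.
case: x; case: y; rewrite vlam.unlock /lam /= ?expr0 ?expr1 ?mulr1 ?mul1r.
- exact: gY2.
- exact: gZV.
- by rewrite mulrC gZV.
- exact: gX2.
Qed.

Lemma gXn_even k : gX ^+ (k * 2) = 1 :> R.
Proof. by rewrite mulnC exprM expr2 gX2 expr1n. Qed.

Lemma gXn_odd k : gX ^+ k = gX ^+ odd k :> R.
Proof. by rewrite -{1}(odd_double_half k) exprD -muln2 gXn_even mulr1. Qed.

(** Exchanging the two factors costs [vlam x false], reversing the arrow costs [gX], and v_+ in
    first position is neutral. *)
Lemma merge_coef_pf x : merge_coef x false x = gX * vlam x false.
Proof. by case: x; rewrite vlam_pf //= gX2. Qed.

Lemma merge_coef_fp x : merge_coef false x x = 1.
Proof. by case: x. Qed.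

(** * Circles and their representatives *)

Lemma labellingP (T : finType) (e : rel T) (v : {ffun T -> bool}) :
  reflect (forall x y, e x y -> v x = v y) (labelling e v).
Proof.
apply: (iffP forallP) => [h x y exy | h x].
  by move/forallP: (h x) => /(_ y); rewrite exy => /eqP.
by apply/forallP => y; apply/implyP => /h ->.
Qed.

Lemma connect_inv (T : finType) (rT : eqType) (e : rel T) (f : T -> rT) :
  (forall x y, e x y -> f x = f y) -> forall x y, connect e x y -> f x = f y.
Proof.
move=> h x y /connectP [p]; elim: p x => [|z p IH] x /= => [_ -> //|].
by case/andP => /h -> /IH.
Qed.

(* [K] sends every point to the first point of its circle. *)
Definition canonical_rep (T : finType) (e : rel T) (o : seq T) (K : T -> T) : Prop :=
  [/\ forall x y, connect e x y = (K x == K y), forall x, K (K x) = K x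
    & forall x, (index (K x) o <= index x o)%N].

(** A point survives the recursion exactly when nothing before it is connected to it. *)
Lemma circles_filter (T : finType) (e : rel T) (o : seq T) :
    symmetric (connect e) -> uniq o ->
  circles e o = [seq y <- o | find (connect e y) o == index y o].
Proof.
move=> sym; elim: o => //= x o IH /andP [xo uo]; rewrite connect0 eqxx /=; congr (_ :: _).
rewrite IH // -filter_predI; apply: eq_in_filter => y yo /=.
have -> : (x == y) = false by apply: contraNF xo => /eqP ->.
by rewrite (sym x y); case: connect.
Qed.

Section CanonicalRep.
Variables (T : finType) (e : rel T) (o : seq T) (K : T -> T).
Hypotheses (uo : uniq o) (mem_o : forall x, x \in o) (cK : canonical_rep e o K).

Let KE x y : connect e x y = (K x == K y). Proof. by case: cK. Qed.
Let KK x : K (K x) = K x. Proof. by case: cK. Qed.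
Let K_le x : (index (K x) o <= index x o)%N. Proof. by case: cK. Qed.

Lemma circlesE : circles e o = [seq x <- o | K x == x].
Proof.
rewrite circles_filter //; last by move=> x y; rewrite !KE eq_sym.
apply: eq_filter => y; apply/eqP/eqP => [fy | Ky].
  have nlt : ~~ (index (K y) o < find (connect e y) o)%N.
    apply/negP => h; have := @before_find _ (K y) (connect e y) o _ h.
    by rewrite nth_index // KE KK eqxx.
  have := K_le y; rewrite fy -leqNgt in nlt => le.
  by apply: (@index_inj _ y o) => //; apply/eqP; rewrite eqn_leq le nlt.
have hy : has (connect e y) o by apply/hasP; exists y.
have hn := nth_find y hy; rewrite KE Ky in hn.
have lo : (find (connect e y) o < size o)%N by rewrite -has_find.
apply/eqP; rewrite eqn_leq; apply/andP; split.
  rewrite leqNgt; apply/negP => h; have := @before_find _ y (connect e y) o _ h.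
  by rewrite nth_index // connect0.
have := K_le (nth y o (find (connect e y) o)).
by rewrite -(eqP hn) index_uniq.
Qed.

Lemma labelling_rep v x : labelling e v -> v (K x) = v x.
Proof.
move/labellingP/connect_inv/(_ (K x) x); apply.
by rewrite KE KK.
Qed.

Lemma rep_labelling (v : {ffun T -> bool}) : (forall x, v (K x) = v x) -> labelling e v.
Proof.
move=> vK; apply/labellingP => x y /(@connect1 _ e).
by rewrite KE -(vK x) -(vK y) => /eqP ->.
Qed.

Lemma big_circles (F : T -> R) :
  \prod_(x <- circles e o) F x = \prod_(x | K x == x) F x.
Proof.
rewrite circlesE big_filter; apply: perm_big; apply: uniq_perm => //.
  exact: index_enum_uniq.
by move=> x; rewrite mem_o mem_index_enum.
Qed.

(** The coefficient is a product over the pairs of circles that the two orders list oppositely, so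
    any functions increasing along the lists may stand for the positions. Entries such as [low_l s]
    need not be first points of their circles, hence [map K]. *)
Lemma reorder_rank (v : {ffun T -> bool}) (r r' : T -> nat) (l l' : seq T) :
    labelling e v ->
    pairwise (fun x y => (r x < r y)%N) (map K l) ->
    pairwise (fun x y => (r' x < r' y)%N) (map K l') ->
    {subset map K l <= map K l'} ->
  reorder e v l l' = \prod_(x <- map K l) \prod_(y <- map K l | (r x < r y)%N && (r' y < r' x)%N)
                        vlam (v x) (v y).
Proof.
move=> lv; set L := map K l'; move=> pl pl' sub.
have idx x : find (connect e x) l' = index (K x) L.
  rewrite /L /index find_map; apply: eq_find => z /=.
  by rewrite KE eq_sym.
have mono x y : x \in L -> y \in L -> (index y L < index x L)%N = (r' y < r' x)%N.
  have lt z w : w \in L -> (index z L < index w L)%N -> (r' z < r' w)%N.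
    move=> wL h; have zL : z \in L by rewrite -index_mem (ltn_trans h) // index_mem.
    have := elimT (pairwiseP z) pl' (index z L) (index w L).
    by rewrite !inE !index_mem !nth_index //; apply.
  move=> xL yL; apply/idP/idP; first exact: lt.
  move=> h; rewrite ltnNge; apply/negP; rewrite leq_eqVlt => /orP [/eqP E|].
    by move: h; rewrite (@index_inj _ x L _ _ xL yL E) ltnn.
  by move/(lt _ _ yL)/(ltn_trans h); rewrite ltnn.
elim: l pl sub => [|x l IH] /=; first by rewrite big_nil.
case/andP => xl pl sub.
have sub' : {subset map K l <= L} by move=> z zl; apply: sub; rewrite inE zl orbT.
have xL : K x \in L by apply: sub; rewrite inE eqxx.
rewrite IH // big_cons; congr (_ * _).
  rewrite big_cons ltnn /= [RHS]big_map [RHS]big_mkcond [LHS]big_mkcond /=.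
  apply: eq_big_seq => y yl; rewrite !idx.
  have Kyl : K y \in map K l by apply: map_f.
  by rewrite mono //; [rewrite (allP xl _ Kyl) /= vlam.unlock !labelling_rep | exact: sub'].
apply: eq_big_seq => y yl; rewrite big_cons.
by have /ltnW := allP xl _ yl; rewrite leqNgt => /negbTE ->.
Qed.

End CanonicalRep.

(** * Merging two circles *)

Section MergeStep.
Variables (T : finType) (o : seq T) (e0 : rel T).
Variables (done : seq (saddle T)) (s : saddle T) (pending : seq (saddle T)).
Variables (K K' : T -> T) (v vn : {ffun T -> bool}).

Let e := curve e0 done (s :: pending).
Let e' := curve e0 (s :: done) pending.
Let X := K (low_l s).
Let U := K (up_l s).
Let r x := index x o.

Hypotheses (uo : uniq o) (mem_o : forall x, x \in o).
Hypotheses (cK : canonical_rep e o K) (cK' : canonical_rep e' o K').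
Hypotheses (XU : X != U) (rXU : K' (low_l s) = if (r X < r U)%N then X else U).
Hypothesis K'E : forall z, K z != X -> K z != U -> K' z = K z.
Hypothesis K'm : forall z, (K z == X) || (K z == U) -> K' z = K' (low_l s).
Hypotheses (lv : labelling e v) (lvn : labelling e' vn).
Hypothesis vnE : forall z, K z != X -> K z != U -> vn z = v z.
(** Two labels v_- would make the merge vanish. Otherwise the merged circle is labelled v_- as soon
    as one of the two was, and [v] goes to a multiple of the single labelling [vn]. *)
Hypotheses (vXU : ~~ (v X && v U)) (vnX : vn X = v X || v U).

Let W := K' (low_l s).

Let KE x y : connect e x y = (K x == K y). Proof. by case: cK. Qed.
Let KK x : K (K x) = K x. Proof. by case: cK. Qed.

Let r_inj : injective r.
Proof. by move=> x y; apply: (@index_inj _ x o). Qed.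

Let sorted_r (P : pred T) : pairwise (fun x y => (r x < r y)%N) [seq x <- o | P x].
Proof.
apply: pairwise_filter.
apply/(pairwiseP (low_l s)) => i j; rewrite !inE => io jo ij.
by rewrite /r !index_uniq.
Qed.

Let C := circles e o.
Let l := [seq z <- C | ~~ connect e (low_l s) z && ~~ connect e (up_l s) z].

Let lE : l = [seq z <- o | [&& K z == z, z != X & z != U]].
Proof.
rewrite /l /C (circlesE uo mem_o cK) -filter_predI; apply: eq_filter => z /=.
rewrite !KE andbC; case: eqP => //= Kz.
by rewrite Kz ![_ == z]eq_sym.
Qed.

Let map_fixed (P : pred T) (f : T -> T) : (forall z, P z -> f z = z) ->
  [seq f z | z <- [seq z <- o | P z]] = [seq z <- o | P z].
Proof.
move=> h; rewrite -[RHS]map_id; apply/eq_in_map => z.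
by rewrite mem_filter => /andP [/h].
Qed.

(** Ranks in the two intermediate orders of [saddle_coef]: the circles taking part in the merge
    stand in front, the others keep the order of [o]. *)
Let r1 z := if z == X then 0%N else if z == U then 1%N else (r z).+2.
Let r2 z := if z == W then 0%N else (r z).+1.

Let r1X : r1 X = 0%N. Proof. by rewrite /r1 eqxx. Qed.
Let r1U : r1 U = 1%N. Proof. by rewrite /r1 eq_sym (negbTE XU) eqxx. Qed.
Let r1E z : z != X -> z != U -> r1 z = (r z).+2.
Proof. by rewrite /r1 => /negbTE -> /negbTE ->. Qed.

(** Only [X] and [U] move forward, so an inverted pair consists of one of them and a circle that
    used to precede it. The second product omits [X], which ends up ahead of [U]. *)
Lemma merge_reorder_front :
  reorder e v C [:: low_l s, up_l s & l] =
  (\prod_(p | (K p == p) && (r p < r X)%N) vlam (v p) (v X)) *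
  (\prod_(p | [&& K p == p, p != X & (r p < r U)%N]) vlam (v p) (v U)).
Proof.
have KC : map K C = C.
  by rewrite /C (circlesE uo mem_o cK) map_fixed // => z /eqP.
have Kl : map K l = l by rewrite lE map_fixed // => z /andP [/eqP].
rewrite (reorder_rank (r := r) (r' := r1) cK) //; first last.
- rewrite KC => z; rewrite /C (circlesE uo mem_o cK) mem_filter mem_o andbT /=.
  move=> Kz; rewrite Kl lE !inE mem_filter mem_o andbT Kz /=.
  by rewrite -/X -/U; case: eqP => //=; case: eqP.
- rewrite /= Kl -/X -/U r1X r1U /=; apply/and3P; split.
  + apply/allP => z; rewrite lE mem_filter => /andP [/and3P [_ zX zU] _].
    by rewrite r1E.
  + apply/allP => z; rewrite lE mem_filter => /andP [/and3P [_ zX zU] _].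
    by rewrite r1E.
  + have := sorted_r [pred z | [&& K z == z, z != X & z != U]].
    rewrite -lE; apply: (sub_in_pairwise (P := mem l)); last exact/allP.
    move=> z w; rewrite /= lE !mem_filter; move=> /andP [/and3P [_ zX zU] _] /andP [/and3P [_ wX wU] _].
    by rewrite !r1E.
- by rewrite KC /C (circlesE uo mem_o cK); apply: sorted_r.
rewrite KC (eq_bigr (fun p => \prod_(q | (K q == q) && ((r p < r q)%N && (r1 q < r1 p)%N))
  vlam (v p) (v q))); last first.
  move=> p _; rewrite big_mkcond (big_circles uo mem_o cK) -big_mkcondr //=.
rewrite (big_circles uo mem_o cK).
(* Index the inverted pairs by the circle that moves forward. *)
rewrite (exchange_big_dep (fun q => K q == q)) /=; last by move=> p q _ /andP [].
rewrite (bigD1 X) ?KK //= [X in _ * X](bigD1 U) /=; last by rewrite KK eqxx eq_sym.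
rewrite [X in _ * (_ * X)]big1 ?mulr1; last first.
  move=> q /andP [/andP [_ qX] qU]; apply: big1 => p /andP [_ /and3P [_ h]].
  rewrite (r1E qX qU); have [->|pX] := eqVneq p X; first by rewrite r1X.
  have [->|pU] := eqVneq p U; first by rewrite r1U.
  by rewrite r1E // !ltnS => /(ltn_trans h); rewrite ltnn.
congr (_ * _); apply: eq_bigl => p; rewrite ?KK ?eqxx /=; case: (K p == p) => //=.
  rewrite r1X; have [->|pX] := eqVneq p X; first by rewrite r1X ltnn.
  have [->|pU] := eqVneq p U; first by rewrite r1U andbT.
  by rewrite r1E // andbT.
rewrite r1U; have [->|pX] := eqVneq p X; first by rewrite r1X andbF.
have [->|pU] := eqVneq p U; first by rewrite r1U ltnn.
by rewrite r1E // andbT.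
Qed.

(** The merged circle, represented by the earlier of [X] and [U], goes back past the circles that
    precede it. *)
Lemma merge_reorder_back :
  reorder e' vn (low_l s :: l) (circles e' o) =
  \prod_(p | [&& K p == p, p != X, p != U & (r p < r W)%N]) vlam (vn X) (v p).
Proof.
have lK' z : z \in l -> K' z = z.
  by rewrite lE mem_filter => /andP [/and3P [/eqP Kz zX zU] _]; rewrite K'E ?Kz.
have K'l : map K' l = l.
  by rewrite -[RHS]map_id; apply/eq_in_map => z /lK'.
have KW : K' W = W by case: cK' => _ ->.
have WXU : (W == X) || (W == U) by rewrite /W rXU; case: ifP; rewrite eqxx ?orbT.
have lW z : z \in l -> z != W.
  rewrite lE mem_filter => /andP [/and3P [_ zX zU] _].
  by apply: contraTneq WXU => <-; rewrite (negbTE zX) (negbTE zU).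
rewrite (reorder_rank (r := r2) (r' := r) cK') //; first last.
- move=> z; rewrite /= K'l inE -/W (circlesE uo mem_o cK') => zin.
  have K'z : K' z = z by case/orP: zin => [/eqP ->|/lK'].
  by apply/mapP; exists z; rewrite ?mem_filter ?mem_o ?K'z ?eqxx.
- by rewrite (circlesE uo mem_o cK') map_fixed; [apply: sorted_r | move=> z /eqP].
- rewrite /= K'l -/W {1}/r2 eqxx; apply/andP; split.
    by apply/allP => z /lW zW; rewrite /r2 (negbTE zW).
  have := sorted_r [pred z | [&& K z == z, z != X & z != U]].
  rewrite -lE; apply: (sub_in_pairwise (P := mem l)); last exact/allP.
  move=> z w /lW zW /lW wW.
  by rewrite /r2 (negbTE zW) (negbTE wW).
rewrite /= K'l -/W big_cons [X in _ * X]big1_seq ?mulr1; last first.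
  move=> p /andP [_ pl]; rewrite big1_seq // => q; rewrite inE => /andP [/andP [h h'] ].
  case/orP => [/eqP qW | ql]; first by rewrite /r2 qW eqxx in h.
  move: h; rewrite /r2 (negbTE (lW _ pl)) (negbTE (lW _ ql)) ltnS => /(ltn_trans h').
  by rewrite ltnn.
rewrite big_cons ltnn /=.
have vW : vn W = vn X.
  by rewrite -(labelling_rep cK' X lvn) (K'm (z := X)) // KK eqxx.
rewrite vW [LHS]big_mkcond lE big_filter [RHS]big_mkcond /=.
rewrite (perm_big (index_enum T)) /=; last first.
  apply: uniq_perm => //; first exact: index_enum_uniq.
  by move=> x; rewrite mem_o mem_index_enum.
rewrite big_mkcond /=; apply: eq_bigr => p _.
case Kp: (K p == p) => //=; case pX: (p == X) => //=; case pU: (p == U) => //=.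
have pl : p \in l by rewrite lE mem_filter mem_o Kp pX pU.
by rewrite /r2 eqxx (negbTE (lW _ pl)) /= (vnE (z := p)) // (eqP Kp) ?pX ?pU.
Qed.

Lemma saddle_coef_merge (v' : {ffun T -> bool}) :
  saddle_coef o e0 done s pending v v' = (v' == vn)%:R *
   ((\prod_(p | (K p == p) && (r p < r X)%N) vlam (v p) (v X)) *
    (\prod_(p | [&& K p == p, p != X & (r p < r U)%N]) vlam (v p) (v U)) *
    merge_coef (v X) (v U) (v X || v U) *
    \prod_(p | [&& K p == p, p != X, p != U & (r p < r W)%N]) vlam (v X || v U) (v p)).
Proof.
have vX : v (low_l s) = v X by rewrite (labelling_rep cK).
have vU : v (up_l s) = v U by rewrite (labelling_rep cK).
have vnx : vn (low_l s) = vn X.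
  rewrite -(labelling_rep cK' (low_l s) lvn) -(labelling_rep cK' X lvn).
  by rewrite [K' X]K'm ?KK ?eqxx.
have im : is_merge e0 done s pending by rewrite /is_merge KE.
rewrite /saddle_coef -/e -/e' im lv andTb.
have [->|nv] := eqVneq v' vn.
  rewrite lvn mul1r ifT; last first.
    apply/forallP => z; apply/implyP; rewrite !KE => /andP [h1 h2].
    by apply/eqP; rewrite vnE // eq_sym.
  rewrite -/C -/l merge_reorder_front.
  by rewrite merge_reorder_back vX vU vnx vnX.
rewrite mul0r; case: ifP => // /andP [lv' /forallP h].
(* A labelling other than [vn] that passes the test differs from it on the merged circle, where
   [merge_coef] vanishes. *)
have [E|E] := boolP (v' (low_l s) == v X || v U).
  case/eqP: nv; apply/ffunP => z.
  have [zXU|] := boolP ((K z == X) || (K z == U)).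
    rewrite -(labelling_rep cK' z lv') -(labelling_rep cK' z lvn) K'm //.
    by rewrite (labelling_rep cK' _ lv') (labelling_rep cK' _ lvn) vnx vnX (eqP E).
  rewrite negb_or => /andP [zX zU]; rewrite vnE //; apply/esym/eqP.
  by apply: implyP (h z) _; rewrite !KE ![_ == K z]eq_sym zX zU.
rewrite vX vU (_ : merge_coef _ _ _ = 0) ?mulr0 ?mul0r //.
by move: E vXU; case: (v X); case: (v U); case: (v' _).
Qed.

Lemma F_chron_merge (c : R) :
  F_chron o e0 done (s :: pending) [ffun z => c * (z == v)%:R] =
  F_chron o e0 (s :: done) pending [ffun z => c *
   ((\prod_(p | (K p == p) && (r p < r X)%N) vlam (v p) (v X)) *
    (\prod_(p | [&& K p == p, p != X & (r p < r U)%N]) vlam (v p) (v U)) *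
    merge_coef (v X) (v U) (v X || v U) *
    \prod_(p | [&& K p == p, p != X, p != U & (r p < r W)%N]) vlam (v X || v U) (v p))
    * (z == vn)%:R].
Proof.
rewrite /=; congr F_chron; apply/ffunP => v'; rewrite !ffunE (bigD1 v) //= big1 => [|w wv].
  by rewrite ffunE eqxx mulr1 addr0 saddle_coef_merge mulrCA; apply: mulrC.
by rewrite ffunE (negbTE wv) mulr0 mul0r.
Qed.

(* In the three cases below one of the two circles is labelled v_+, so that the
   merged circle has the label of the other one; the transpositions that bring
   this other circle to the front then cancel against those that move the merged
   circle back, because [vlam x y * vlam y x = 1]. *)
Lemma F_chron_merge_pure_up (c : R) : (r X < r U)%N -> v U = false ->
  F_chron o e0 done (s :: pending) [ffun z => c * (z == v)%:R] =
  F_chron o e0 (s :: done) pending [ffun z =>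
    c * (gX * \prod_(p | (K p == p) && (r p < r U)%N) vlam (v p) false) * (z == vn)%:R].
Proof.
move=> lt vUf; rewrite F_chron_merge; congr F_chron; apply/ffunP => z; rewrite !ffunE.
congr (_ * _ * _); rewrite vUf orbF merge_coef_pf /W rXU lt.
(* The factor [p = X] on the right comes from [merge_coef_pf], not from a transposition. *)
rewrite [in RHS](bigD1 X) /=; last by rewrite KK eqxx.
rewrite [X in _ * X = _](eq_bigl (fun p => (K p == p) && (r p < r X)%N)); last first.
  move=> p; case: (K p == p) => //=; have [->|_] := eqVneq p X; first by rewrite ltnn.
  by have [->|_] := eqVneq p U; first by rewrite ltnNge ltnW.
rewrite [X in _ * X * _ * _ = _](eq_bigl (fun p => (K p == p) && (r p < r U)%N && (p != X))); last first.
  by move=> p; rewrite -andbA; congr (_ && _); rewrite andbC.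
rewrite mulrC -!mulrA [LHS]mulrA -big_split big1 /=.
  by rewrite mul1r mulrC -mulrA.
by move=> p _; rewrite vlamC.
Qed.

Lemma F_chron_merge_old (c : R) : (r U < r X)%N -> v X = false ->
  F_chron o e0 done (s :: pending) [ffun z => c * (z == v)%:R] =
  F_chron o e0 (s :: done) pending [ffun z =>
    c * (\prod_(p | (K p == p) && (r p < r X)%N) vlam (v p) false) * (z == vn)%:R].
Proof.
move=> lt vXf; rewrite F_chron_merge; congr F_chron; apply/ffunP => z; rewrite !ffunE.
congr (_ * _ * _); rewrite vXf orFb merge_coef_fp /W rXU ltnNge (ltnW lt) /=.
rewrite -!mulrA -[RHS]mulr1; congr (_ * _).
rewrite mul1r.
rewrite [X in _ * X](eq_bigl (fun p => [&& K p == p, p != X & (r p < r U)%N])).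
  by rewrite -big_split big1 //= => p _; rewrite vlamC.
by move=> p; have [->|_] := eqVneq p U; rewrite ?ltnn ?andbF.
Qed.

(** Here the cancellation is partial: [U] passes the circles between [X] and [U] on its way to the
    front, but the merged circle returns only to the place of [X]. *)
Lemma F_chron_merge_new (c : R) : (r X < r U)%N -> v X = false ->
  F_chron o e0 done (s :: pending) [ffun z => c * (z == v)%:R] =
  F_chron o e0 (s :: done) pending [ffun z =>
    c * ((\prod_(p | (K p == p) && (r p < r X)%N) vlam (v p) false) *
         \prod_(p | [&& K p == p, (r X < r p)%N & (r p < r U)%N]) vlam (v p) (v U))
    * (z == vn)%:R].
Proof.
move=> lt vXf; rewrite F_chron_merge; congr F_chron; apply/ffunP => z; rewrite !ffunE.
congr (_ * _ * _); rewrite vXf orFb merge_coef_fp /W rXU lt.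
rewrite -!mulrA; congr (_ * _).
rewrite mul1r.
rewrite (bigID (fun p => (r p < r X)%N)) /= mulrAC.
rewrite [X in _ * X * _](eq_bigl (fun p => [&& K p == p, p != X & (r p < r U)%N] && (r p < r X)%N)).
  rewrite -big_split big1 /= ?mul1r => [|p _]; last by rewrite vlamC.
  apply: eq_bigl => p; rewrite -!andbA; congr (_ && _).
  have [->|pX] := eqVneq p X; first by rewrite ltnn.
  have rXp : (r X == r p) = false by apply: contraNF pX => /eqP /r_inj ->.
  by rewrite -leqNgt [(r X <= r p)%N]leq_eqVlt rXp /= andbC.
move=> p; case: (K p == p) => //=; case: (p == X) => //=.
have [->|_] := eqVneq p U; first by rewrite ltnn.
by case h: (r p < r X)%N; rewrite ?andbF // (ltn_trans h).
Qed.

End MergeStep.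

(** * Crossingless matchings *)

Section Matchings.
Variable n : nat.
Implicit Types (a b : B n) (i j k : 'I_n.*2).

Lemma B_neq b j : val b j != j.
Proof. by case/andP: (valP b) => /forallP /(_ j) /andP []. Qed.

Lemma BK b : involutive (val b).
Proof. by move=> j; case/andP: (valP b) => /forallP /(_ j) /andP [_ /eqP]. Qed.

Lemma B_ltNge b j : (val b j < j)%N = ~~ (j < val b j)%N.
Proof.
by have := B_neq b j; rewrite -val_eqE /= -leqNgt ltn_neqAle => ->.
Qed.

Definition right_ends b : seq 'I_n.*2 := [seq j <- rev (enum 'I_n.*2) | (val b j < j)%N].

Definition arc_right b j : 'I_n.*2 := if (val b j < j)%N then j else val b j.

Lemma arc_right_id b j : (val b j < j)%N -> arc_right b j = j.
Proof. by rewrite /arc_right => ->. Qed.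

Lemma arc_rightB b j : arc_right b (val b j) = arc_right b j.
Proof. by rewrite /arc_right BK [in RHS]B_ltNge; case: ifP. Qed.

Lemma arc_rightP b j : (val b (arc_right b j) < arc_right b j)%N.
Proof. by rewrite /arc_right; case: ifP => //; rewrite BK B_ltNge => /negbFE. Qed.

Lemma arc_right_ge b j : (j <= arc_right b j)%N.
Proof. by rewrite /arc_right; case: ifP => // /negbT; rewrite -leqNgt. Qed.

Lemma mem_right_ends b j : (j \in right_ends b) = (val b j < j)%N.
Proof. by rewrite mem_filter mem_rev mem_enum andbT. Qed.

(** [val b] exchanges right and left endpoints, so the right endpoints are half of the 2n points. *)
Lemma size_right_ends b : size (right_ends b) = n.
Proof.
have -> : size (right_ends b) = #|[pred j | (val b j < j)%N]|.
  have u : uniq (right_ends b) by rewrite filter_uniq // rev_uniq enum_uniq.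
  by rewrite -(card_uniqP u); apply: eq_card => j; rewrite mem_right_ends.
have h : (#|[pred j | (val b j < j)%N]| + #|[predC [pred j | (val b j < j)%N]]| = n.*2)%N.
  by rewrite cardC card_ord.
have e : #|[predC [pred j | (val b j < j)%N]]| = #|[pred j | (val b j < j)%N]|.
  rewrite -(card_image (inv_inj (BK b)) [pred j | (val b j < j)%N]).
  apply: eq_card => j; rewrite -[in RHS](BK b j) (mem_image (inv_inj (BK b))) !inE BK.
  by rewrite B_ltNge negbK.
by rewrite e addnn in h; apply: double_inj.
Qed.

Lemma right_ends_sorted b : pairwise (fun i j => (j < i)%N) (right_ends b).
Proof.
have tr : transitive (fun i j : 'I_n.*2 => (j < i)%N).
  by move=> y x z h1 h2; apply: ltn_trans h2 h1.
rewrite -(sorted_pairwise tr); apply: (sorted_filter tr); rewrite rev_sorted.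
by have := iota_ltn_sorted 0 n.*2; rewrite -val_enum_ord sorted_map.
Qed.

(* The arcs are contracted in the order of [right_ends], so that the arcs in
   [pre] have been contracted and those in [suf] have not. *)
Definition arc_state b (pre suf : seq 'I_n.*2) : Prop := rev pre ++ suf = right_ends b.

Lemma arc_state_mem b pre suf j : arc_state b pre suf ->
  (j \in pre) || (j \in suf) = (val b j < j)%N.
Proof. by move=> st; rewrite -mem_right_ends -st mem_cat mem_rev. Qed.

(** [pre] grows at its head, as [done] does in [F_chron]; this is why [arc_state] reverses it. *)
Lemma arc_state_next b j pre suf : arc_state b pre (j :: suf) -> arc_state b (j :: pre) suf.
Proof. by rewrite /arc_state rev_cons cat_rcons. Qed.

Lemma arc_state_lt b pre suf i j : arc_state b pre suf ->
  i \in pre -> j \in suf -> (j < i)%N.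
Proof.
move=> st ip js; have := right_ends_sorted b.
rewrite -st pairwise_cat => /and3P [/allrelP h _ _].
by apply: h; rewrite ?mem_rev.
Qed.

Lemma arc_state_head b pre suf j i : arc_state b pre (j :: suf) -> i \in suf -> (i < j)%N.
Proof.
by move/arc_state_next => st; apply: (arc_state_lt st); rewrite inE eqxx.
Qed.

Lemma arc_state_notin b pre suf j : arc_state b pre (j :: suf) -> j \notin pre.
Proof.
move=> st; apply/negP => jp.
by have := arc_state_lt st jp (mem_head j suf); rewrite ltnn.
Qed.

(** Contraction runs from right to left, so the contracted arcs are those to the right of the
    current one. Membership in [pre] can then be compared with ranks of points. *)
Lemma arc_state_gt b pre suf j i : arc_state b pre (j :: suf) ->
  (val b i < i)%N -> (i \in pre) = (j < i)%N.
Proof.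
move=> st; rewrite -(arc_state_mem i st) => /orP [ip | ].
  by rewrite ip (arc_state_lt st ip) // mem_head.
move=> i_s; have ij : (i <= j)%N.
  by move: i_s; rewrite inE => /orP [/eqP -> // | /(arc_state_head st) /ltnW].
rewrite ltnNge ij; apply/negbTE/negP => ip.
by have := arc_state_lt st ip i_s; rewrite ltnn.
Qed.

Lemma arc_state_up b pre suf i j : arc_state b pre suf ->
  i \in pre -> (val b j < j)%N -> (i <= j)%N -> j \in pre.
Proof.
move=> st ip; rewrite -(arc_state_mem j st) => /orP [//|js].
by rewrite leqNgt (arc_state_lt st ip js).
Qed.

Lemma arc_state0 b : arc_state b [::] (right_ends b).
Proof. by []. Qed.

Lemma arc_state_full b pre j : arc_state b pre [::] -> (val b j < j)%N -> j \in pre.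
Proof. by move=> st; rewrite -(arc_state_mem j st) orbF. Qed.

End Matchings.

(** * The circles of a closed tangle *)

Definition col n (x : strip n n) : 'I_n.*2 := match x with inl i | inr i => i end.

Section Columns.
Variables (n : nat) (a b : B n).
Implicit Types (i j k : 'I_n.*2).

(** The identity strands join the two points of each column, so the circles of
    [closure1 a b (id_flat n)] correspond to the components of this relation. *)
Definition col_rel : rel 'I_n.*2 := fun i j => (j == val a i) || (j == val b i).

Lemma col_connect_sym : connect_sym col_rel.
Proof.
apply: sym_connect_sym => i j; rewrite /col_rel.
by rewrite -(inj_eq (inv_inj (BK a))) -[j == val b i](inj_eq (inv_inj (BK b))) !BK
  ![_ == i]eq_sym.
Qed.

Definition col_max j : 'I_n.*2 := [arg max_(k > j | connect col_rel j k) (k : nat)].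

Lemma connect_col_max j : connect col_rel j (col_max j).
Proof. by rewrite /col_max; case: arg_maxnP. Qed.

Lemma col_max_ge j k : connect col_rel j k -> (k <= col_max j)%N.
Proof. by rewrite /col_max; case: arg_maxnP => // m _ h; apply: h. Qed.

Lemma col_maxE i j : connect col_rel i j = (col_max i == col_max j).
Proof.
have le x y : connect col_rel x y -> (col_max y <= col_max x)%N.
  by move=> xy; apply: col_max_ge; apply: connect_trans xy (connect_col_max y).
apply/idP/eqP => [ij | E].
  by apply/val_inj/eqP; rewrite /= eqn_leq !le // col_connect_sym.
apply: connect_trans (connect_col_max i) _.
by rewrite E col_connect_sym connect_col_max.
Qed.

Lemma col_maxL j : col_max (val a j) = col_max j.
Proof. by apply/eqP; rewrite -col_maxE col_connect_sym connect1 // /col_rel eqxx. Qed.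

Lemma col_maxR j : col_max (val b j) = col_max j.
Proof. by apply/eqP; rewrite -col_maxE col_connect_sym connect1 // /col_rel eqxx orbT. Qed.

Lemma col_maxK j : col_max (col_max j) = col_max j.
Proof. by apply/eqP; rewrite -col_maxE col_connect_sym connect_col_max. Qed.

Lemma col_max_le j : (j <= col_max j)%N.
Proof. exact: col_max_ge. Qed.

(** The partner lies on the same circle, hence to the left. So among the [a]-arcs of a circle, the
    one ending at its rightmost column is contracted first. *)
Lemma col_max_rightL j : (val a (col_max j) < col_max j)%N.
Proof.
rewrite ltn_neqAle val_eqE B_neq /=; apply: col_max_ge.
by rewrite col_maxE col_maxL col_maxK.
Qed.

Lemma arc_right_maxL j : col_max (arc_right a j) = col_max j.
Proof. by rewrite /arc_right; case: ifP; rewrite ?col_maxL. Qed.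

Lemma arc_right_maxR j : col_max (arc_right b j) = col_max j.
Proof. by rewrite /arc_right; case: ifP; rewrite ?col_maxR. Qed.

End Columns.

Lemma link_sym (T : eqType) (p q x y : T) : link p q x y = link p q y x.
Proof. by rewrite /link orbC [(x == q) && _]andbC [(x == p) && _]andbC. Qed.

Lemma push_sym (U T : finType) (f : U -> T) (g : U -> U) : involutive g -> symmetric (push f g).
Proof.
move=> gK; suff h x y : push f g x y -> push f g y x by move=> x y; apply/idP/idP; apply: h.
by case/existsP => u /andP [/eqP -> /eqP ->]; apply/existsP; exists (g u); rewrite gK !eqxx.
Qed.

Lemma push_id (n : nat) (T : finType) (f : strip n n -> T) (i : 'I_n.*2) :
  push f (val (id_flat n)) (f (inl i)) (f (inr i)).
Proof. by apply/existsP; exists (inl i); rewrite /= ffunE !eqxx. Qed.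

Lemma pushE (U T : finType) (f : U -> T) (g : U -> U) u : push f g (f u) (f (g u)).
Proof. by apply/existsP; exists u; rewrite !eqxx. Qed.

Lemma id_flatK n : involutive (val (id_flat n)).
Proof. by case=> i; rewrite /= !ffunE. Qed.

Lemma col_id_flat n (x : strip n n) : col (val (id_flat n) x) = col x.
Proof. by case: x => i; rewrite /= ffunE. Qed.

Lemma canonical_repI (T : finType) (e : rel T) (o : seq T) (K : T -> T) :
    symmetric e -> (forall x y, e x y -> K x = K y) ->
    (forall x, connect e x (K x)) -> (forall x, (index (K x) o <= index x o)%N) ->
  canonical_rep e o K.
Proof.
move=> sym inv conn le; split=> //.
  move=> x y; apply/idP/eqP => [/(connect_inv inv) //| E].
  apply: connect_trans (conn x) _.
  by rewrite E (sym_connect_sym sym) conn.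
by move=> x; rewrite -(connect_inv inv (conn x)).
Qed.

Lemma connect_homo (T T' : finType) (e : rel T) (e' : rel T') (f : T -> T') :
  (forall x y, e x y -> connect e' (f x) (f y)) ->
  forall x y, connect e x y -> connect e' (f x) (f y).
Proof.
move=> h x y /connectP [p]; elim: p x => [|z p IH] x /= => [_ -> //|].
by case/andP => /h xz /IH {}IH /IH; apply: connect_trans.
Qed.

Section StripEnum.
Variable n : nat.
Let N := n.*2.

Lemma index_rev_enum (j : 'I_N) : index j (rev (enum 'I_N)) = (N - j.+1)%N.
Proof.
have lt : (N - j.+1 < N)%N by have := ltn_ord j; lia.
have h : nth j (rev (enum 'I_N)) (N - j.+1) = j.
  rewrite nth_rev size_enum_ord //; apply: val_inj; rewrite /= nth_enum_ord //.
    by have := ltn_ord j; lia.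
  by have := ltn_ord j; lia.
by rewrite -[in LHS]h index_uniq ?size_rev ?size_enum_ord // rev_uniq enum_uniq.
Qed.

(** Closed form of the position in [strip_enum], which turns comparisons of positions into linear
    arithmetic. *)
Definition strip_rank (x : strip n n) : nat :=
  match x with inr j => (N - j.+1)%N | inl j => (N + (N - j.+1))%N end.

Lemma index_strip_enum x : index x (strip_enum n n) = strip_rank x.
Proof.
rewrite /strip_enum index_cat size_map size_rev size_enum_ord.
case: x => j /=; last first.
  by rewrite map_f ?mem_rev ?mem_enum // index_map ?index_rev_enum //; apply: inr_inj.
rewrite ifN; last by apply/negP => /mapP [].
by rewrite index_map ?index_rev_enum //; apply: inl_inj.
Qed.

Lemma mem_strip_enum x : x \in strip_enum n n.
Proof. by rewrite mem_cat; case: x => j; rewrite map_f ?orbT // mem_rev mem_enum. Qed.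

Lemma strip_enum_uniq : uniq (strip_enum n n).
Proof.
rewrite cat_uniq !map_inj_uniq ?rev_uniq ?enum_uniq ?andbT //=; try by move=> ? ? [].
by apply/hasPn => x /mapP [i _ ->]; apply/negP => /mapP [].
Qed.

Definition strip2_rank (x : strip2 n n n) : nat :=
  match x with inl u => strip_rank u | inr u => (N + N + strip_rank u)%N end.

Lemma index_strip2_enum x : index x (strip2_enum n n n) = strip2_rank x.
Proof.
have sz : size (strip_enum n n) = (N + N)%N.
  by rewrite size_cat !size_map size_rev size_enum_ord.
rewrite /strip2_enum index_cat size_map sz; case: x => u /=.
  by rewrite map_f ?mem_strip_enum // index_map ?index_strip_enum //; apply: inl_inj.
rewrite ifN; last by apply/negP => /mapP [].
by rewrite index_map ?index_strip_enum //; apply: inr_inj.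
Qed.

Lemma mem_strip2_enum x : x \in strip2_enum n n n.
Proof. by rewrite mem_cat; case: x => u; rewrite map_f ?orbT // mem_strip_enum. Qed.

Lemma strip2_enum_uniq : uniq (strip2_enum n n n).
Proof.
rewrite cat_uniq !map_inj_uniq ?strip_enum_uniq ?andbT //=; try by move=> ? ? [].
by apply/hasPn => x /mapP [i _ ->]; apply/negP => /mapP [].
Qed.

End StripEnum.

Section Closure.
Variables (n : nat) (a b : B n).

Let e := closure1 a b (id_flat n).

Lemma closure1_sym : symmetric e.
Proof.
move=> x y; rewrite /e /closure1 (push_sym _ (BK a)) (push_sym _ (BK b)).
by rewrite (push_sym _ (@id_flatK n)).
Qed.

Lemma closure1_col x y : e x y -> col_max a b (col x) = col_max a b (col y).
Proof.
case/or3P => /existsP [u /andP [/eqP -> /eqP ->]] /=; first by rewrite col_maxL.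
  by rewrite col_id_flat.
by rewrite col_maxR.
Qed.

(** The top line is enumerated first, from right to left, so a circle is first met at the top of its
    rightmost column. *)
Lemma closure1_rep : canonical_rep e (strip_enum n n) (fun x => inr (col_max a b (col x))).
Proof.
have idc i : connect e (inl i) (inr i).
  by apply: connect1; rewrite /e /closure1 (push_id id) orbT.
have csym := sym_connect_sym closure1_sym.
apply: canonical_repI closure1_sym _ _ _ => [x y /closure1_col -> //|x|x].
  apply: (@connect_trans _ _ (inr (col x))); first by case: x.
  apply: (connect_homo (f := inr)) (connect_col_max a b (col x)) => i j.
  case/orP => /eqP ->.
    apply: connect_trans (_ : connect e (inr i) (inl i)) _; first by rewrite csym.
    apply: connect_trans (idc _); apply: connect1.
    by rewrite /e /closure1 (pushE inl).
  by apply: connect1; rewrite /e /closure1 (pushE inr) !orbT.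
rewrite !index_strip_enum /=; have := col_max_le a b (col x).
by case: x => i /=; have := ltn_ord i; lia.
Qed.

Lemma labelling_col_max (v : {ffun strip n n -> bool}) x : labelling e v ->
  v (inr (col_max a b (col x))) = v x.
Proof. exact: (labelling_rep closure1_rep). Qed.

Lemma labelling_col (v : {ffun strip n n -> bool}) x y : labelling e v ->
  col_max a b (col x) = col_max a b (col y) -> v x = v y.
Proof. by move=> lv E; rewrite -(labelling_col_max x lv) E labelling_col_max. Qed.

Lemma labelling_const c : labelling e [ffun=> c].
Proof. by apply/labellingP => x y _; rewrite !ffunE. Qed.

(** As [lam] is bimultiplicative, this is lam(|x|, (1, 0)) for the basis element x labelled by [v]:
    the cost of moving a factor v_+ in front of x. *)
Definition circle_weight (v : {ffun strip n n -> bool}) : R :=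
  \prod_(k | col_max a b k == k) vlam (v (inr k)) false.

Lemma circle_weightE (v : {ffun strip n n -> bool}) :
  circle_weight v =
    gX ^+ count (fun x => ~~ v x) (circles e (strip_enum n n)) *
    gZ ^+ count v (circles e (strip_enum n n)).
Proof.
transitivity (\prod_(x <- circles e (strip_enum n n)) vlam (v x) false).
  rewrite (big_circles (strip_enum_uniq n) (@mem_strip_enum n) closure1_rep) big_sumType /=.
  by rewrite big_pred0_eq mul1r.
elim: circles => [|x s IH]; first by rewrite big_nil mul1r.
rewrite big_cons IH /= vlam_pf; case: (v x); rewrite /= !add0n exprS.
  by rewrite mulrCA.
by rewrite mulrA.
Qed.

Lemma labelling_count0 (v : {ffun strip n n -> bool}) : labelling e v ->
  count v (circles e (strip_enum n n)) = 0%N -> v = [ffun=> false].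
Proof.
move=> lv /eqP; rewrite -leqn0 leqNgt -has_count => /hasPn h.
apply/ffunP => x; rewrite ffunE -(labelling_col_max x lv); apply/negbTE/h.
rewrite (circlesE (strip_enum_uniq n) (@mem_strip_enum n) closure1_rep).
by rewrite mem_filter mem_strip_enum /= col_maxK eqxx.
Qed.

End Closure.

(** In the closure of [a] by its own reflection every circle consists of one arc and its mirror
    image. *)
Lemma col_max_diag n (a : B n) j : col_max a a j = arc_right a j.
Proof.
have := connect_col_max a a j; move/(connect_inv (f := arc_right a)) => -> //.
  by rewrite arc_right_id // col_max_rightL.
by move=> x y /orP [] /eqP ->; rewrite arc_rightB.
Qed.

Lemma size_circles_diag n (a : B n) :
  size (circles (closure1 a a (id_flat n)) (strip_enum n n)) = n.
Proof.
rewrite (circlesE (strip_enum_uniq n) (@mem_strip_enum n) (closure1_rep a a)).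
rewrite -[RHS](size_right_ends a) /strip_enum filter_cat !filter_map !size_cat !size_map.
rewrite [X in (_ + X)%N](_ : _ = 0%N) ?addn0; last by rewrite size_filter count_pred0.
congr size; apply: eq_filter => j /=; rewrite col_max_diag (inj_eq (@inr_inj _ _)).
by rewrite /arc_right; case: ifP => _; rewrite ?eqxx // (negbTE (B_neq a j)).
Qed.

(** * Contracting the arcs of a matching *)

Section TwoLayers.
Variables (n : nat) (a c m : B n).

Definition lo (j : 'I_n.*2) : strip2 n n n := inl (inr j).
Definition hi (j : 'I_n.*2) : strip2 n n n := inr (inl j).

Definition arc_saddle (j : 'I_n.*2) : saddle (strip2 n n n) :=
  Saddle (lo (val m j)) (lo j) (hi (val m j)) (hi j).

Let e0 := W_fixed a c (id_flat n) (id_flat n).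

Definition arc_curve (pre suf : seq 'I_n.*2) : rel (strip2 n n n) :=
  curve e0 (map arc_saddle pre) (map arc_saddle suf).

Lemma W_saddlesE : W_saddles n n m = map arc_saddle (right_ends m).
Proof. by []. Qed.

Variables (pre suf : seq 'I_n.*2).
Hypothesis st : arc_state m pre suf.
Let e := arc_curve pre suf.

Lemma arc_curve_sym : symmetric e.
Proof.
have hs (P Q : saddle (strip2 n n n) -> strip2 n n n) (P' Q' : saddle (strip2 n n n) -> strip2 n n n) s x y :
    has (fun s => link (P s) (Q s) x y || link (P' s) (Q' s) x y) s =
    has (fun s => link (P s) (Q s) y x || link (P' s) (Q' s) y x) s.
  by apply: eq_has => u; rewrite /= link_sym [link _ _ x y in X in _ || X]link_sym.
move=> x y; rewrite /e /arc_curve /curve hs [X in [|| _, _ | X]]hs; congr (_ || _).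
rewrite /e0 /W_fixed (push_sym _ (BK a)) (push_sym _ (BK c)).
by rewrite (push_sym inl (@id_flatK n)) (push_sym inr (@id_flatK n)).
Qed.

Lemma arc_curve_inv (rT : eqType) (K : strip2 n n n -> rT) :
    (forall i, K (inl (inl (val a i))) = K (inl (inl i))) ->
    (forall i, K (inl (inl i)) = K (lo i)) ->
    (forall i, K (hi i) = K (inr (inr i))) ->
    (forall i, K (inr (inr (val c i))) = K (inr (inr i))) ->
    (forall j, arc_right m j \in pre -> K (lo j) = K (hi j)) ->
    (forall j, arc_right m j \in suf -> K (lo (val m j)) = K (lo j) /\ K (hi (val m j)) = K (hi j)) ->
  forall x y, e x y -> K x = K y.
Proof.
move=> Ka K1 K2 Kc Kp Ks.
have lk p q x y : K p = K q -> link p q x y -> K x = K y.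
  by move=> h /orP [] /andP [/eqP -> /eqP ->].
have re j : (j \in pre) || (j \in suf) -> arc_right m j = j.
  by rewrite (arc_state_mem j st); apply: arc_right_id.
move=> x y /or3P [].
- case/or4P => /existsP [u /andP [/eqP -> /eqP ->]].
  + by rewrite Ka.
  + by case: u => i; rewrite ffunE; rewrite K1.
  + by case: u => i; rewrite ffunE; rewrite K2.
  + by rewrite Kc.
- rewrite has_map => /hasP [j jp] /=.
  have rj : arc_right m j = j by apply: re; rewrite jp.
  case/orP; apply: lk => /=; apply: Kp; rewrite ?arc_rightB rj //.
rewrite has_map => /hasP [j js] /=.
have rj : arc_right m j = j by apply: re; rewrite js orbT.
have [] := Ks j; first by rewrite rj.
by move=> h1 h2 /orP []; apply: lk.
Qed.

Lemma arc_curve_connect_sym : connect_sym e.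
Proof. exact: sym_connect_sym arc_curve_sym. Qed.

Lemma arc_curve_fixed x y : e0 x y -> connect e x y.
Proof. by move=> h; apply: connect1; rewrite /e /arc_curve /curve h. Qed.

Lemma arc_curve_lo i : connect e (inl (inl i)) (lo i).
Proof. by apply: arc_curve_fixed; rewrite /e0 /W_fixed (push_id inl) !orbT. Qed.

Lemma arc_curve_hi i : connect e (hi i) (inr (inr i)).
Proof. by apply: arc_curve_fixed; rewrite /e0 /W_fixed (push_id inr) !orbT. Qed.

Lemma arc_curve_bottom i : connect e (lo i) (lo (val a i)).
Proof.
apply: connect_trans (arc_curve_lo _); apply: (@connect_trans _ _ (inl (inl i))).
  by rewrite arc_curve_connect_sym arc_curve_lo.
by apply: arc_curve_fixed; rewrite /e0 /W_fixed (pushE (fun i => inl (inl i))).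
Qed.

Lemma arc_curve_top i : connect e (hi i) (hi (val c i)).
Proof.
apply: connect_trans (arc_curve_hi _) _; apply: (@connect_trans _ _ (inr (inr (val c i)))).
  by apply: arc_curve_fixed; rewrite /e0 /W_fixed (pushE (fun i => inr (inr i))) !orbT.
by rewrite arc_curve_connect_sym arc_curve_hi.
Qed.

Lemma arc_curve_done j : arc_right m j \in pre -> connect e (lo j) (hi j).
Proof.
move=> jp; apply: connect1; rewrite /e /arc_curve /curve orbA orbC orbA; apply/orP; right.
rewrite has_map; apply/hasP; exists (arc_right m j) => //=.
rewrite /arc_right; case: ifP => _ /=; first by rewrite /link !eqxx orbT.
by rewrite BK /link !eqxx.
Qed.

Lemma arc_curve_pending j : arc_right m j \in suf ->
  connect e (lo j) (lo (val m j)) /\ connect e (hi j) (hi (val m j)).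
Proof.
move=> js.
have h x y : (link (lo (val m (arc_right m j))) (lo (arc_right m j)) x y
           || link (hi (val m (arc_right m j))) (hi (arc_right m j)) x y) -> connect e x y.
  move=> h; apply: connect1; rewrite /e /arc_curve /curve !orbA; apply/orP; right.
  by rewrite has_map; apply/hasP; exists (arc_right m j).
split; apply: h; rewrite /arc_right; case: ifP => _; rewrite ?BK /link !eqxx ?orbT //.
Qed.

Lemma arc_curve_cases j : (arc_right m j \in pre) || (arc_right m j \in suf).
Proof. by rewrite (arc_state_mem _ st) arc_rightP. Qed.

End TwoLayers.

(** * Multiplication by a unit on the right *)

Section RightUnit.
Variables (n : nat) (a c : B n) (v : {ffun strip n n -> bool}).

Let M := col_max a c.

(** The upper layer is the closure of [c] by its reflection, one circle per arc. Such a circle keeps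
    its own representative until its arc is contracted; then it joins a circle of the lower layer,
    whose representatives never change. *)
Definition right_rep (pre : seq 'I_n.*2) (x : strip2 n n n) : strip2 n n n :=
  match x with
  | inl z => lo (M (col z))
  | inr z => if arc_right c (col z) \in pre then lo (M (col z)) else inr (inr (arc_right c (col z)))
  end.

(** The conjunction labels by v_+ the circles of the unit that have not merged yet. *)
Definition right_label (pre : seq 'I_n.*2) : {ffun strip2 n n n -> bool} :=
  [ffun x : strip2 n n n =>
    match x with inl z => v z | inr z => (arc_right c (col z) \in pre) && v z end].

Lemma right_rep_canonical pre suf : arc_state c pre suf ->
  canonical_rep (arc_curve a c c pre suf) (strip2_enum n n n) (right_rep pre).
Proof.
move=> st; have csym := arc_curve_connect_sym a c c pre suf.
have lolo i j : connect (col_rel a c) i j -> connect (arc_curve a c c pre suf) (lo i) (lo j).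
  apply: connect_homo => x y /orP [] /eqP ->; first exact: arc_curve_bottom.
  case/orP: (arc_curve_cases st x) => [xp | /(arc_curve_pending a c pre) [] //].
  apply: connect_trans (arc_curve_done a c suf xp) _.
  apply: connect_trans (arc_curve_top a c c pre suf x) _.
  by rewrite csym; apply: arc_curve_done; rewrite arc_rightB.
have hiA j : arc_right c j \notin pre ->
    connect (arc_curve a c c pre suf) (hi j) (inr (inr (arc_right c j))).
  move=> jp; apply: connect_trans (arc_curve_hi _ _ _ _ _ _).
  have := arc_curve_cases st j; rewrite (negbTE jp) /= => /(arc_curve_pending a c pre) [_].
  by rewrite /arc_right; case: ifP => // _ _; apply: connect0.
apply: canonical_repI (arc_curve_sym a c c pre suf) _ _ _.
- apply: (arc_curve_inv st) => [i|i|i|i|j jp|j js] //=.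
  + by rewrite /M col_maxL.
  + by rewrite arc_rightB /M col_maxR.
  + by rewrite jp.
  by rewrite arc_rightB /M col_maxR.
- case=> z /=.
    apply: connect_trans (lolo _ _ (connect_col_max a c (col z))).
    by case: z => i //=; apply: arc_curve_lo.
  apply: (@connect_trans _ _ (hi (col z))).
    by case: z => i //=; rewrite csym arc_curve_hi.
  case: ifP => [jp | /negbT]; last exact: hiA.
  apply: connect_trans (lolo _ _ (connect_col_max a c (col z))).
  by rewrite csym arc_curve_done.
move=> x; rewrite !index_strip2_enum; case: x => z /=.
  by have := col_max_le a c (col z); rewrite -/M; case: z => i /=; have := ltn_ord i; lia.
case: ifP => _ /=; have := ltn_ord (M (col z)); have := arc_right_ge c (col z).
  by case: z => i /=; have := ltn_ord i; lia.
by case: z => i /=; have := ltn_ord i; lia.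
Qed.

Hypothesis lv : labelling (closure1 a c (id_flat n)) v.

Lemma right_labelling pre suf : arc_state c pre suf ->
  labelling (arc_curve a c c pre suf) (right_label pre).
Proof.
move=> st; apply: (rep_labelling (right_rep_canonical st)) => x; rewrite !ffunE.
case: x => z /=; first exact: (labelling_col_max z lv).
case: ifP => jp; first by rewrite -(labelling_col_max z lv).
by rewrite /= arc_right_id ?arc_rightP // jp.
Qed.

(** The circle at [j] is the first one left in the upper layer, since the arcs to its right have
    been contracted. The circles before it are exactly those of the lower layer, so the weight is
    the same at every step. *)
Lemma F_chron_right_step pre j suf (k : R) : arc_state c pre (j :: suf) ->
  F_chron (strip2_enum n n n) (W_fixed a c (id_flat n) (id_flat n))
    (map (arc_saddle c) pre) (map (arc_saddle c) (j :: suf))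
    [ffun z => k * (z == right_label pre)%:R] =
  F_chron (strip2_enum n n n) (W_fixed a c (id_flat n) (id_flat n))
    (map (arc_saddle c) (j :: pre)) (map (arc_saddle c) suf)
    [ffun z => k * (gX * circle_weight a c v) * (z == right_label (j :: pre))%:R].
Proof.
move=> st; have st' := arc_state_next st.
have jj : (val c j < j)%N by rewrite -(arc_state_mem j st) mem_head orbT.
have jp := arc_state_notin st.
have Aj : arc_right c j = j by apply: arc_right_id.
set s := arc_saddle c j.
have KX : right_rep pre (low_l s) = lo (M j) by rewrite /= /M col_maxR.
have K'X : right_rep (j :: pre) (low_l s) = lo (M j) by rewrite /= /M col_maxR.
have KU : right_rep pre (up_l s) = inr (inr j) by rewrite /= arc_rightB Aj (negbTE jp).
have XU : (index (lo (M j)) (strip2_enum n n n) < index (inr (inr j) : strip2 n n n) (strip2_enum n n n))%N.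
  by rewrite !index_strip2_enum /=; have := ltn_ord j; lia.
have vU : right_label pre (inr (inr j)) = false by rewrite ffunE /= Aj (negbTE jp).
apply: etrans (F_chron_merge_pure_up (s := s) (strip2_enum_uniq n) (@mem_strip2_enum n)
  (right_rep_canonical st) (right_rep_canonical st') _ _ _ _ (right_labelling st)
  (right_labelling st') _ _ _ k _ _) _; rewrite ?KX ?KU //.
- by rewrite XU K'X.
- case=> z //= _; rewrite inE; have [->|//] := eqVneq (arc_right c (col z)) j.
  by rewrite (negbTE jp) eqxx.
- rewrite K'X => x; case: x => z /=.
    by rewrite orbF => /eqP [->].
  have Mz : M (arc_right c (col z)) = M (col z) by rewrite /M arc_right_maxR.
  rewrite inE; case: (arc_right c (col z) \in pre).
    by rewrite orbT orbF => /eqP [->].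
  by case/orP => /eqP // [Az]; rewrite -Mz Az eqxx.
- case=> z _; rewrite !ffunE //= inE; have [->|//] := eqVneq (arc_right c (col z)) j.
  by rewrite (negbTE jp) eqxx.
- by rewrite vU andbF.
- by rewrite vU orbF !ffunE.
congr F_chron; apply/ffunP => w; rewrite !ffunE; congr (_ * (_ * _) * _).
(* Of the four lines of points, only the upper line of the lower layer carries representatives that
   precede [inr (inr j)]. *)
rewrite !big_sumType /=.
rewrite [X in X * _ * _]big_pred0 => [|i]; last by [].
rewrite [X in _ * (X * _)]big_pred0 => [|i]; last first.
  by case: ifP.
rewrite [X in _ * (_ * X)]big_pred0 => [|i]; last first.
  case: ifP => //= ip; rewrite !(inj_eq (@inr_inj _ _)) !index_strip2_enum /=.
  case: eqP => //= iA; have := arc_rightP c i; rewrite iA => ii.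
  have := arc_state_gt st ii; rewrite -{1}iA ip => /esym/negbT; rewrite -leqNgt.
  by have := ltn_ord j; lia.
rewrite !mulr1 mul1r.
apply: eq_big => [i | i _]; last by rewrite ffunE.
rewrite !index_strip2_enum /= !(inj_eq (@inl_inj _ _)) (inj_eq (@inr_inj _ _)).
case: eqP => //= _.
by have := ltn_ord j; have := ltn_ord i; lia.
Qed.

Lemma F_chron_right pre suf (k : R) : arc_state c pre suf ->
  F_chron (strip2_enum n n n) (W_fixed a c (id_flat n) (id_flat n))
    (map (arc_saddle c) pre) (map (arc_saddle c) suf)
    [ffun z => k * (z == right_label pre)%:R] =
  [ffun z => k * (gX * circle_weight a c v) ^+ size suf * (z == Defs.double v)%:R].
Proof.
elim: suf pre k => [|j suf IH] pre k st.
  apply/ffunP => z; rewrite !ffunE mulr1; congr (_ * (_ == _)%:R).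
  apply/ffunP => -[] x; rewrite !ffunE // (arc_state_full st) //.
  exact: arc_rightP.
rewrite F_chron_right_step // IH; last exact: arc_state_next.
by apply/ffunP => z; rewrite !ffunE exprS; congr (_ * _); rewrite -[LHS]mulrA.
Qed.

End RightUnit.

(** * Multiplication by a unit on the left *)

Section LeftUnit.
Variables (n : nat) (a c : B n) (v : {ffun strip n n -> bool}).

Let M := col_max a c.
Let r (x : strip2 n n n) := index x (strip2_enum n n n).

(** Now the lower layer belongs to the unit, one circle per arc of [a]. The upper circle through
    column [j] is first merged at its rightmost column [M j]; from then on it is represented by
    [lo (M j)], because the lower layer is enumerated first. *)
Definition left_rep (pre : seq 'I_n.*2) (x : strip2 n n n) : strip2 n n n :=
  match x with
  | inl z => if arc_right a (col z) \in pre then lo (M (col z)) else lo (arc_right a (col z))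
  | inr z => if M (col z) \in pre then lo (M (col z)) else inr (inr (M (col z)))
  end.

Definition left_label (pre : seq 'I_n.*2) : {ffun strip2 n n n -> bool} :=
  [ffun x : strip2 n n n =>
    match x with inl z => (arc_right a (col z) \in pre) && v z | inr z => v z end].

(* The cost of moving a circle labelled v_+ to the left of the circles of
   "c-bar a" that have already been merged with one. *)
Definition left_weight (pre : seq 'I_n.*2) : R :=
  \prod_(k | (M k == k) && (k \in pre)) vlam (v (inr k)) false.

Lemma arc_right_col_max j : (arc_right a j <= M j)%N.
Proof. by rewrite /M -(arc_right_maxL a c j); apply: col_max_le. Qed.

Lemma left_col_max_in pre suf j : arc_state a pre suf -> arc_right a j \in pre -> M j \in pre.
Proof.
move=> st jp; apply: (arc_state_up st jp); first exact: col_max_rightL.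
exact: arc_right_col_max.
Qed.

Lemma left_rep_canonical pre suf : arc_state a pre suf ->
  canonical_rep (arc_curve a c a pre suf) (strip2_enum n n n) (left_rep pre).
Proof.
move=> st; have csym := arc_curve_connect_sym a c a pre suf.
have hihi i j : connect (col_rel a c) i j -> connect (arc_curve a c a pre suf) (hi i) (hi j).
  apply: connect_homo => x y /orP [] /eqP ->; last exact: arc_curve_top.
  case/orP: (arc_curve_cases st x) => [xp | /(arc_curve_pending a c pre) [] //].
  apply: (@connect_trans _ _ (lo x)).
    by rewrite csym; apply: arc_curve_done.
  apply: connect_trans (arc_curve_bottom a c a pre suf x) _.
  by apply: arc_curve_done; rewrite arc_rightB.
have himax j : connect (arc_curve a c a pre suf) (hi j) (hi (M j)).
  exact: hihi (connect_col_max a c j).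
have loM j : M j \in pre -> connect (arc_curve a c a pre suf) (hi (M j)) (lo (M j)).
  by move=> jp; rewrite csym; apply: arc_curve_done; rewrite arc_right_id ?col_max_rightL.
have loA j : connect (arc_curve a c a pre suf) (lo j) (lo (arc_right a j)).
  by rewrite /arc_right; case: ifP => _; [apply: connect0 | apply: arc_curve_bottom].
apply: canonical_repI (arc_curve_sym a c a pre suf) _ _ _.
- apply: (arc_curve_inv st) => [i|i|i|i|j jp|j js] //=.
  + by rewrite arc_rightB /M col_maxL.
  + by rewrite /M col_maxR.
  + by rewrite jp (left_col_max_in st jp).
  by rewrite arc_rightB /M col_maxL.
- case=> z /=.
    apply: (@connect_trans _ _ (lo (col z))).
      by case: z => i //=; apply: arc_curve_lo.
    case: ifP => // jp; apply: connect_trans (loM _ (left_col_max_in st jp)).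
    by apply: connect_trans (himax _); apply: arc_curve_done.
  apply: (@connect_trans _ _ (hi (M (col z)))).
    apply: connect_trans (himax _).
    by case: z => i //=; rewrite csym arc_curve_hi.
  by case: ifP => [/loM // | _]; apply: arc_curve_hi.
move=> x; rewrite !index_strip2_enum; case: x => z /=.
  have := arc_right_col_max (col z); have := arc_right_ge a (col z).
  by case: ifP => _; case: z => i /=; have := ltn_ord i; lia.
have := col_max_le a c (col z); rewrite -/M; have := ltn_ord (M (col z)).
by case: ifP => _; case: z => i /=; have := ltn_ord i; lia.
Qed.

Hypothesis lv : labelling (closure1 a c (id_flat n)) v.

Lemma left_labelling pre suf : arc_state a pre suf ->
  labelling (arc_curve a c a pre suf) (left_label pre).
Proof.
move=> st; apply: (rep_labelling (left_rep_canonical st)) => x; rewrite !ffunE.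
have AM j : arc_right a (M j) = M j by rewrite arc_right_id // col_max_rightL.
case: x => z /=; case: ifP => jp /=.
- by rewrite AM (left_col_max_in st jp) (labelling_col_max z lv).
- by rewrite arc_right_id ?arc_rightP // jp.
- by rewrite AM jp (labelling_col_max z lv).
exact: (labelling_col_max z lv).
Qed.

Section Step.
Variables (pre suf : seq 'I_n.*2) (j : 'I_n.*2).
Hypothesis st : arc_state a pre (j :: suf).

Let st' := arc_state_next st.
Let s := arc_saddle a j.
Let U := if M j \in pre then lo (M j) else inr (inr j).

Let jj : (val a j < j)%N.
Proof. by rewrite -(arc_state_mem j st) mem_head orbT. Qed.

Let Aj : arc_right a j = j. Proof. exact: arc_right_id. Qed.

Let jp : (j \in pre) = false. Proof. exact/negbTE/(arc_state_notin st). Qed.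

(** [M j = j] means that the upper circle through [j] meets its first saddle now. *)
Let Mj : (M j \in pre) = (M j != j).
Proof.
rewrite (arc_state_gt st) ?col_max_rightL // ltn_neqAle col_max_le andbT.
by rewrite -val_eqE eq_sym.
Qed.

Lemma left_rep_low : left_rep pre (low_l s) = lo j.
Proof. by rewrite /= arc_rightB Aj jp. Qed.

Lemma left_rep_up : left_rep pre (up_l s) = U.
Proof. by rewrite /= /U /M col_maxL -/M; case: ifP => //; rewrite Mj => /negbFE /eqP ->. Qed.

Lemma left_rep_low_next : left_rep (j :: pre) (low_l s) = lo (M j).
Proof. by rewrite /= arc_rightB Aj mem_head /M col_maxL. Qed.

Let rXU : (r (lo j) < r U)%N = (M j == j).
Proof.
rewrite /U Mj /r; have := col_max_le a c j; rewrite -/M.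
case: eqVneq => [_|neq] /=; rewrite !index_strip2_enum /=; have := ltn_ord j; have := ltn_ord (M j).
  by lia.
by lia.
Qed.

Lemma left_rep_eq z : left_rep pre z != lo j -> left_rep pre z != U ->
  left_rep (j :: pre) z = left_rep pre z.
Proof.
case: z => z /=.
  rewrite inE; have [-> |//] := eqVneq (arc_right a (col z)) j.
  by rewrite jp eqxx.
move=> _; rewrite inE; have [E|//] := eqVneq (M (col z)) j.
have : M j = j by rewrite -{1}E /M col_maxK.
by move=> Mjj; rewrite E /U Mj Mjj eqxx /= jp eqxx.
Qed.

Lemma left_rep_merge z : (left_rep pre z == lo j) || (left_rep pre z == U) ->
  left_rep (j :: pre) z = lo (M j).
Proof.
have Mz k : M (arc_right a k) = M k by rewrite /M arc_right_maxL.
have MM k : M (M k) = M k by rewrite /M col_maxK.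
case: z => z /=.
  rewrite inE; case zp: (arc_right a (col z) \in pre); rewrite ?orbT ?orbF.
    case/orP => [/eqP [E] | ].
      by have := left_col_max_in st zp; rewrite E jp.
    by rewrite /U; case: ifP => // _ /eqP [->].
  have [E _|nE] := eqVneq (arc_right a (col z)) j; first by rewrite -(Mz (col z)) E.
  case/orP => [/eqP [E] | ]; first by rewrite E eqxx in nE.
  by rewrite /U; case: ifP => // h /eqP [E]; rewrite E h in zp.
case zp: (M (col z) \in pre); rewrite inE ?zp ?orbT ?orbF.
  case/orP => [/eqP [E] | ]; first by rewrite E jp in zp.
  by rewrite /U; case: ifP => // _ /eqP [->].
case/orP => [/eqP //|]; rewrite /U; case: ifP => // _ /eqP [E].
by rewrite E eqxx -{2}E MM E.
Qed.

Let labU : left_label pre U = v (inr j).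
Proof.
rewrite /U ffunE; case: ifP => [Mp|_] //=.
rewrite arc_right_id ?col_max_rightL // Mp.
exact: (labelling_col_max (inr j) lv).
Qed.

Let labX : left_label pre (lo j) = false.
Proof. by rewrite ffunE /= Aj jp. Qed.

Lemma left_label_eq z : left_rep pre z != lo j -> left_label (j :: pre) z = left_label pre z.
Proof.
case: z => z; rewrite !ffunE //= inE; have [->|//] := eqVneq (arc_right a (col z)) j.
by rewrite jp eqxx.
Qed.

Lemma left_label_low_next : left_label (j :: pre) (lo j) = v (inr j).
Proof.
rewrite ffunE /= Aj mem_head /=.
by apply: (labelling_col (y := inr j) lv).
Qed.

(** Representatives before [lo j] lie on the line [lo] to the right of [j], where all arcs have been
    contracted; they stand for the circles already merged. *)
Lemma left_weight_low :
  \prod_(p | (left_rep pre p == p) && (r p < r (lo j))%N) vlam (left_label pre p) false =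
  left_weight pre.
Proof.
rewrite !big_sumType /=.
rewrite [X in X * _ * _]big_pred0 => [|i]; last by case: ifP.
rewrite [X in _ * (X * _)]big_pred0 => [|i]; last by case: ifP.
rewrite [X in _ * (_ * X)]big_pred0 => [|i]; last first.
  by rewrite /r !index_strip2_enum andbC; apply/negbTE/negP => /andP [] /=; have := ltn_ord j; lia.
rewrite !mulr1 mul1r.
have right k : M k = k -> (val a k < k)%N by move=> <-; apply: col_max_rightL.
have rk k : (r (lo k) < r (lo j))%N = (j < k)%N.
  by rewrite /r !index_strip2_enum /=; have := ltn_ord j; have := ltn_ord k; lia.
have loE i k : (lo i == lo k) = (i == k) by apply/eqP/eqP => [[]|->].
apply: eq_big => [i | i]; rewrite ?rk ?ffunE /=.
  have [Mi|Mi] := eqVneq (M i) i.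
    have ii := right i Mi; rewrite arc_right_id // (arc_state_gt st ii) Mi.
    by case: ifP => _; rewrite loE eqxx.
  case: ifP => [_|Ai]; first by rewrite loE (negbTE Mi).
  rewrite loE; case: eqVneq => //= iA; have := arc_rightP a i; rewrite iA => ii.
  by apply/negbTE; rewrite -(arc_state_gt st ii) -iA Ai.
case: ifP => //= Ai; rewrite loE => /andP [/eqP iA ij].
have := arc_rightP a i; rewrite iA => ii.
by move: Ai; rewrite iA (arc_state_gt st ii) ij.
Qed.

(** Upper circles reaching further right than [j] have already been merged, so between the two
    representatives there remain only the v_+ circles of the unit, one for each arc in [suf]. *)
Lemma left_weight_between : M j = j ->
  \prod_(p | [&& left_rep pre p == p, (r (lo j) < r p)%N & (r p < r U)%N])
    vlam (left_label pre p) (left_label pre U) = vlam false (v (inr j)) ^+ size suf.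
Proof.
move=> Mjj; have UE : U = inr (inr j) by rewrite /U Mj Mjj eqxx.
rewrite labU UE !big_sumType /=.
rewrite [X in X * _ * _]big_pred0 => [|i]; last by case: ifP.
rewrite [X in _ * (X * _)]big_pred0 => [|i]; last by case: ifP.
rewrite [X in _ * (_ * X)]big_pred0 => [|i]; last first.
  case: ifP => //= ip; rewrite (inj_eq (@inr_inj _ _)) (inj_eq (@inr_inj _ _)).
  case: eqP => //= iA; have := col_max_rightL a c i; rewrite -/M iA => ii.
  have := arc_state_gt st ii; rewrite -{1}iA ip /r !index_strip2_enum /= => /esym/negbT.
  by rewrite -leqNgt => ij; apply/negbTE/negP => /andP []; have := ltn_ord i; have := ltn_ord j; lia.
rewrite !mulr1 mul1r.
have usuf : uniq suf.
  have : uniq (right_ends a) by rewrite filter_uniq // rev_uniq enum_uniq.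
  by rewrite -st cat_uniq /= => /and4P [].
have Asuf i : i \in suf -> arc_right a i = i /\ (i \in pre) = false.
  move=> ii; have ri : (val a i < i)%N by rewrite -(arc_state_mem i st) inE ii !orbT.
  split; first exact: arc_right_id.
  by rewrite (arc_state_gt st ri) ltnNge ltnW // (arc_state_head st).
have loE i k : (lo i == lo k) = (i == k) by apply/eqP/eqP => [[]|->].
have PE i : [&& (if arc_right a i \in pre then lo (M i) else lo (arc_right a i)) == lo i,
     (r (lo j) < r (lo i))%N & (r (lo i) < r (inr (inr j)))%N] = (i \in suf).
  have -> : [&& (if arc_right a i \in pre then lo (M i) else lo (arc_right a i)) == lo i,
     (r (lo j) < r (lo i))%N & (r (lo i) < r (inr (inr j)))%N] =
     ((if arc_right a i \in pre then lo (M i) else lo (arc_right a i)) == lo i) && (i < j)%N.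
    by congr (_ && _); rewrite /r !index_strip2_enum /=; have := ltn_ord j; have := ltn_ord i; lia.
  apply/idP/idP => [|is_]; last first.
    by have [-> ->] := Asuf i is_; rewrite eqxx (arc_state_head st).
  case: ifP => Ai; rewrite loE => /andP [/eqP iA ij].
    have ii : (val a i < i)%N by rewrite -iA; apply: col_max_rightL.
    by move: Ai; rewrite arc_right_id // (arc_state_gt st ii) ltnNge (ltnW ij).
  have := arc_rightP a i; rewrite iA -(arc_state_mem i st) inE => /or3P [ip|/eqP E|//].
    by rewrite -iA Ai in ip.
  by rewrite E ltnn in ij.
rewrite (eq_bigl _ _ PE) -(card_uniqP usuf) -prodr_const.
by apply: eq_bigr => i /Asuf [Ai ip]; rewrite ffunE /= Ai ip.
Qed.

Lemma left_weight_next : left_weight (j :: pre) =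
  left_weight pre * (if M j == j then vlam (v (inr j)) false else 1).
Proof.
rewrite /left_weight; case: eqVneq => [Mjj | Mjj].
  rewrite (bigD1 j) /=; last by rewrite Mjj eqxx mem_head.
  rewrite mulrC; congr (_ * _); apply: eq_bigl => k; rewrite inE.
  by case: (eqVneq k j) => [->|]; rewrite ?jp ?andbF ?andbT.
rewrite mulr1; apply: eq_bigl => k; rewrite inE.
by case: (eqVneq k j) => [->|] //; rewrite jp (negbTE Mjj).
Qed.

Lemma F_chron_left_step (k : R) :
  F_chron (strip2_enum n n n) (W_fixed a c (id_flat n) (id_flat n))
    (map (arc_saddle a) pre) (map (arc_saddle a) (j :: suf))
    [ffun z => k * (z == left_label pre)%:R] =
  F_chron (strip2_enum n n n) (W_fixed a c (id_flat n) (id_flat n))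
    (map (arc_saddle a) (j :: pre)) (map (arc_saddle a) suf)
    [ffun z => k * (left_weight pre * (if M j == j then vlam false (v (inr j)) ^+ size suf else 1))
               * (z == left_label (j :: pre))%:R].
Proof.
have UX : lo j != U.
  by rewrite /U; case: ifP => // Mp; apply/eqP => -[E]; rewrite -E jp in Mp.
have labn z : left_rep pre z != lo j -> left_rep pre z != U ->
    left_label (j :: pre) z = left_label pre z.
  by move=> zX _; apply: left_label_eq.
have lowW : left_rep (j :: pre) (low_l s) = if (r (lo j) < r U)%N then lo j else U.
  by rewrite left_rep_low_next rXU /U Mj; case: eqVneq => [->|].
have merge z : (left_rep pre z == lo j) || (left_rep pre z == U) ->
    left_rep (j :: pre) z = left_rep (j :: pre) (low_l s).
  by rewrite left_rep_low_next; apply: left_rep_merge.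
have labW : left_label (j :: pre) (lo j) = left_label pre (lo j) || left_label pre U.
  by rewrite left_label_low_next labX labU.
have labXU : ~~ (left_label pre (lo j) && left_label pre U) by rewrite labX.
have [Mjj|Mjj] := eqVneq (M j) j.
  have lt : (r (lo j) < r U)%N by rewrite rXU Mjj.
  apply: etrans (F_chron_merge_new (s := s) (strip2_enum_uniq n) (@mem_strip2_enum n)
    (left_rep_canonical st) (left_rep_canonical st') _ _ _ _ (left_labelling st)
    (left_labelling st') _ _ _ k _ _) _; rewrite ?left_rep_low ?left_rep_up //.
    exact: left_rep_eq.
  congr F_chron; apply/ffunP => w; rewrite [LHS]ffunE [RHS]ffunE; congr (_ * (_ * _) * _).
    exact: left_weight_low.
  exact: left_weight_between.
have lt : (r U < r (lo j))%N.
  rewrite ltn_neqAle leqNgt rXU (negbTE Mjj) andbT /r.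
  apply: contraNneq UX => E.
  by rewrite (@index_inj _ U _ _ _ (mem_strip2_enum U) (mem_strip2_enum (lo j)) E).
apply: etrans (F_chron_merge_old (s := s) (strip2_enum_uniq n) (@mem_strip2_enum n)
  (left_rep_canonical st) (left_rep_canonical st') _ _ _ _ (left_labelling st)
  (left_labelling st') _ _ _ k _ _) _; rewrite ?left_rep_low ?left_rep_up //.
  exact: left_rep_eq.
congr F_chron; apply/ffunP => w; rewrite [LHS]ffunE [RHS]ffunE mulr1; congr (_ * _ * _).
exact: left_weight_low.
Qed.

End Step.

(** A circle that merges for the first time with [suf] left pays [vlam false _ ^+ size suf] at once
    and contributes [vlam _ false] to the weight of each later step. The two cancel, which leaves
    only the circles merged within [pre]. *)
Lemma F_chron_left pre suf (k : R) : arc_state a pre suf ->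
  F_chron (strip2_enum n n n) (W_fixed a c (id_flat n) (id_flat n))
    (map (arc_saddle a) pre) (map (arc_saddle a) suf)
    [ffun z => k * (z == left_label pre)%:R] =
  [ffun z => k * left_weight pre ^+ size suf * (z == Defs.double v)%:R].
Proof.
elim: suf pre k => [|j suf IH] pre k st.
  apply/ffunP => z; rewrite !ffunE mulr1; congr (_ * (_ == _)%:R).
  by apply/ffunP => -[] x; rewrite !ffunE // (arc_state_full st) // arc_rightP.
rewrite F_chron_left_step // IH; last exact: arc_state_next.
apply/ffunP => z; rewrite !ffunE; congr (_ * _); rewrite -mulrA; congr (_ * _).
rewrite (left_weight_next st) exprS -mulrA; congr (_ * _).
case: eqVneq => _; last by rewrite mulr1 mul1r.
by rewrite exprMn mulrCA -exprMn vlamC expr1n mulr1.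
Qed.

Lemma left_label0 : left_label [::] = glue [ffun=> false] v.
Proof. by apply/ffunP => -[] x; rewrite !ffunE. Qed.

Lemma left_weight0 : left_weight [::] = 1.
Proof. by apply: big_pred0 => k; rewrite andbF. Qed.

End LeftUnit.

(** * Degrees and associators *)

Lemma W_deg_left n (a c : B n) : W_deg a a c (id_flat n) (id_flat n) = (- n%:Z, 0).
Proof.
rewrite /W_deg W_saddlesE.
suff h pre suf : arc_state a pre suf ->
    chron_deg (W_fixed a c (id_flat n) (id_flat n)) (map (arc_saddle a) pre)
      (map (arc_saddle a) suf) = (- (size suf)%:Z, 0).
  by rewrite -[in RHS](size_right_ends a); apply: (h [::]).
elim: suf pre => [|j suf IH] pre st //=.
have -> : is_merge (W_fixed a c (id_flat n) (id_flat n)) (map (arc_saddle a) pre)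
    (arc_saddle a j) (map (arc_saddle a) suf).
  rewrite /is_merge; case: (left_rep_canonical c st) => KE _ _.
  have -> : connect _ (low_l (arc_saddle a j)) (up_l (arc_saddle a j)) = _ := KE _ _.
  rewrite (left_rep_low _ st) (left_rep_up _ st); case: ifP => // Mp.
  by apply/eqP => -[E]; have := arc_state_notin st; rewrite {1}E Mp.
rewrite (IH (j :: pre) (arc_state_next st)) /=; congr (_, _); lia.
Qed.

(** * Changes of chronology that exchange merges *)

Section IotaSwap.
Variables (T : finType) (e0 : rel T).

(* [sep_done K s] (resp. [sep_pending K s]): [K] is constant on the arcs
   present once [s] has been performed (resp. as long as it has not). *)
Definition sep_done (K : T -> bool) (s : saddle T) :=
  (K (low_l s) == K (up_l s)) && (K (low_r s) == K (up_r s)).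
Definition sep_pending (K : T -> bool) (s : saddle T) :=
  (K (low_l s) == K (low_r s)) && (K (up_l s) == K (up_r s)).

(** A function constant along every arc present, but taking different values at the two ends of the
    saddle, puts these ends on different circles. *)
Lemma is_merge_sep (K : T -> bool) done s pending :
    (forall x y, e0 x y -> K x = K y) -> all (sep_done K) done ->
    all (sep_pending K) (s :: pending) -> K (low_l s) != K (up_l s) ->
  is_merge e0 done s pending.
Proof.
move=> K0 Kd Kp; apply: contraNN => /(connect_inv (f := K)) -> // x y.
have lk p q : K p == K q -> link p q x y -> K x = K y.
  by move=> /eqP h /orP [] /andP [/eqP -> /eqP ->].
case/or3P => [/K0 // | | ].
  elim: done Kd => //= u d IH /andP [/andP [h1 h2] /IH {}IH] /orP [/orP [] | //]; exact: lk.
elim: (s :: pending) Kp => //= u d IH /andP [/andP [h1 h2] /IH {}IH] /orP [/orP [] | //]; exact: lk.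
Qed.

Variables (I : eqType) (f g : I -> saddle T) (P Q : pred I) (Kf Kg : I -> T -> bool).
(** [Kf i] has to detect the merge at [f i] in every state in which [f i] is pending, whichever
    other saddles have been performed; hence a condition for each state of each other saddle. [Kg i]
    does the same for [g i]. *)
Hypotheses (Kf0 : forall i, P i -> forall x y, e0 x y -> Kf i x = Kf i y)
  (Kg0 : forall i, Q i -> forall x y, e0 x y -> Kg i x = Kg i y).
Hypotheses (Kfp_f : forall i j, P i -> P j -> sep_pending (Kf i) (f j))
  (Kfp_g : forall i j, P i -> Q j -> sep_pending (Kf i) (g j))
  (Kfd_f : forall i j, P i -> P j -> i != j -> sep_done (Kf i) (f j))
  (Kfd_g : forall i j, P i -> Q j -> sep_done (Kf i) (g j)).
Hypotheses (Kgp_f : forall i j, Q i -> P j -> sep_pending (Kg i) (f j))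
  (Kgp_g : forall i j, Q i -> Q j -> sep_pending (Kg i) (g j))
  (Kgd_f : forall i j, Q i -> P j -> sep_done (Kg i) (f j))
  (Kgd_g : forall i j, Q i -> Q j -> i != j -> sep_done (Kg i) (g j)).
Hypotheses (Kf_merge : forall i, P i -> Kf i (low_l (f i)) != Kf i (up_l (f i)))
  (Kg_merge : forall i, Q i -> Kg i (low_l (g i)) != Kg i (up_l (g i))).

Lemma iota_past_merges p l q q' i : all P p -> all P l -> all Q q -> all Q q' -> Q i ->
    uniq l -> (forall j, j \in l -> j \notin p) -> i \notin q ->
  iota_past e0 (map f p ++ map g q) (map f l) (g i) (map g q') = gX ^+ size l.
Proof.
move=> + + Qq Qq' Qi + + iq; elim: l p => [|b l IH] p //= Pp /andP [Pb Pl] /andP [bl ul] lp.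
have bp : b \notin p by apply: lp; rewrite mem_head.
have m1 : is_merge e0 (map f p ++ map g q) (f b) (g i :: map f l ++ map g q').
  apply: (is_merge_sep (Kf0 Pb)); rewrite /= ?all_cat ?all_map ?Kf_merge //.
    apply/andP; split; apply/allP => j jp /=; last by apply: Kfd_g => //; apply: (allP Qq).
    by apply: Kfd_f => //; [apply: (allP Pp) | apply: contraNneq bp => ->].
  rewrite Kfp_f // Kfp_g //=. apply/andP; split; apply/allP => j jp /=.
    by apply: Kfp_f => //; apply: (allP Pl).
  by apply: Kfp_g => //; apply: (allP Qq').
have m2 : is_merge e0 (f b :: map f p ++ map g q) (g i) (map f l ++ map g q').
  apply: (is_merge_sep (Kg0 Qi)); rewrite /= ?all_cat ?all_map ?Kg_merge //.
    rewrite Kgd_f //=; apply/andP; split; apply/allP => j jp /=.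
      by apply: Kgd_f => //; apply: (allP Pp).
    by apply: Kgd_g => //; [apply: (allP Qq) | apply: contraNneq iq => ->].
  rewrite Kgp_g //=; apply/andP; split; apply/allP => j jp /=.
    by apply: Kgp_f => //; apply: (allP Pl).
  by apply: Kgp_g => //; apply: (allP Qq').
rewrite /iota_exchange m1 m2 exprS; congr (_ * _).
apply: (IH (b :: p)) => //=; first by rewrite Pb.
move=> j jl; rewrite inE negb_or; apply/andP; split.
  by apply: contraNneq bl => <-.
by apply: lp; rewrite inE jl orbT.
Qed.

(** Each saddle of [l] passes each saddle of [q'] once, and every such exchange is one of two
    merges. *)
Lemma iota_swap_merges l q q' : all P l -> uniq l -> all Q q -> all Q q' -> uniq q' ->
    (forall j, j \in q' -> j \notin q) ->
  iota_swap e0 (map g q) (map f l) (map g q') = gX ^+ (size l * size q').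
Proof.
move=> Pl ul; elim: q' q => [|c q' IH] q /= Qq; first by rewrite muln0.
case/andP => Qc Qq' /andP [cq' uq'] disj; rewrite mulnS exprD; congr (_ * _).
  by apply: (iota_past_merges (p := [::])) => //; apply: disj; rewrite mem_head.
apply: (IH (c :: q)) => //=; first by rewrite Qc.
move=> j jq; rewrite inE negb_or disj ?inE ?jq ?orbT // andbT.
by apply: contraNneq cq' => <-.
Qed.

End IotaSwap.

Section IotaH.
(** The flag [t] tells which outer layer is closed by the contracted matching [m]: the bottom one in
    the first associator of [zeta], the top one in the second. *)
Variables (n : nat) (a m d : B n) (t : bool).
Hypotheses (ta : t -> a = m) (td : ~~ t -> d = m).

Let T := strip3 n n n n.

Let lay (x : T) : nat := match x with inl _ => 0 | inr (inl _) => 1 | inr (inr _) => 2 end.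
Let col3 (x : T) : 'I_n.*2 := match x with inl z | inr (inl z) | inr (inr z) => col z end.

Let sep (S : nat -> bool) (j : 'I_n.*2) (x : T) := S (lay x) && (arc_right m (col3 x) == j).

(** The layers on the side of the saddle away from the arbitrary outer layer. They are closures of
    [m] by its reflection, so within them the points of one arc of [m] are cut off from the rest as
    long as the saddle at this arc is pending. *)
Let Sf (k : nat) := t == (k == 0%N).
Let Sg (k : nat) := t == (k != 2%N).

Let f j : saddle T := Saddle (inl (inr (val m j))) (inl (inr j))
  (inr (inl (inl (val m j)))) (inr (inl (inl j))).
Let g j : saddle T := Saddle (inr (inl (inr (val m j)))) (inr (inl (inr j)))
  (inr (inr (inl (val m j)))) (inr (inr (inl j))).

Lemma iota_H_merges :
  iota_H a m m d (id_flat n) (id_flat n) (id_flat n) = gX ^+ (n * n).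
Proof.
have fixed (S : nat -> bool) : (S 0%N -> t) -> (S 2%N -> ~~ t) -> forall j (x y : T),
    H_fixed a d (id_flat n) (id_flat n) (id_flat n) x y -> sep S j x = sep S j y.
  move=> S0 S2 j x y; rewrite /H_fixed /sep.
  case/or4P => [|||/orP []] /existsP [u /andP [/eqP -> /eqP ->]]; rewrite /= ?col_id_flat //.
    by case: (S 0%N) S0 => //= /(_ isT) /ta ->; rewrite arc_rightB.
  by case: (S 2%N) S2 => //= /(_ isT) /td ->; rewrite arc_rightB.
rewrite -[in RHS](size_right_ends m).
have ru : uniq (right_ends m) by rewrite filter_uniq // rev_uniq enum_uniq.
have rp : all (fun j => val m j < j)%N (right_ends m) by apply: filter_all.
have pend_f S i j : sep_pending (sep S i) (f j).
  by rewrite /sep_pending /sep /= arc_rightB !eqxx.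
have pend_g S i j : sep_pending (sep S i) (g j).
  by rewrite /sep_pending /sep /= arc_rightB !eqxx.
have ne i j : (val m j < j)%N -> i != j -> (arc_right m j == i) = false.
  by move=> jj ij; rewrite arc_right_id // eq_sym (negbTE ij).
apply: (@iota_swap_merges _ _ _ f g (fun j => val m j < j)%N (fun j => val m j < j)%N
  (sep Sf) (sep Sg) _ _ _ _ _ _ _ _ _ _ _ _ _ [::]) => //.
- by move=> i _; apply: fixed; rewrite /Sf; case: (t).
- by move=> i _; apply: fixed; rewrite /Sg; case: (t).
- by move=> i j _ jj ij; rewrite /sep_done /sep /= arc_rightB (ne i j) // !andbF.
- by move=> i j _ _; rewrite /sep_done /sep /Sf /= !eqxx.
- by move=> i j _ _; rewrite /sep_done /sep /Sg /= !eqxx.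
- by move=> i j _ jj ij; rewrite /sep_done /sep /= arc_rightB (ne i j) // !andbF.
- by move=> i ii; rewrite /sep /Sf /= arc_rightB arc_right_id // !eqxx; case: (t).
by move=> i ii; rewrite /sep /Sg /= arc_rightB arc_right_id // !eqxx; case: (t).
Qed.

End IotaH.

Lemma lam_merges n (p q : nat) : lam (- n%:Z, 0) (p%:Z, - q%:Z) = gX ^+ (n * p) * gZ ^+ (n * q).
Proof.
rewrite /lam /= mul0r expr0 mulr1 mul0r subr0 mulrNN mulNr abszN -!PoszM absz_nat.
by [].
Qed.

Lemma zeta_gen n (a b : B n) (p q : nat) :
  zeta (a := a) (b := b) (id_flat n, (p%:Z, - q%:Z)) = gX ^+ n * (gX ^+ (n * p) * gZ ^+ (n * q)).
Proof.
rewrite /zeta /alpha /= !W_deg_left (iota_H_merges (t := true)) // (iota_H_merges (t := false)) //.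
have -> : lam (- n%:Z, 0) (n%:Z, 0) = gX ^+ (n * n).
  by have := lam_merges n n 0; rewrite oppr0 muln0 expr0 mulr1.
(* In the first associator the factors X^(n^2) of iota and of [lam] cancel. The factor X^(n^2) of
   the second one equals X^n, because n^2 and n have the same parity. *)
rewrite lam_merges -exprD addnn -muln2 gXn_even mul1r; congr (_ * _).
by rewrite gXn_odd oddM andbb -gXn_odd.
Qed.

(** * The product with units *)

Section ArcAlgebra.
Variable n : nat.
Implicit Types (a b : B n) (u v w : gen n) (x z : H n) (c : B n -> R).

Lemma gen_labelling u : labelling (closure1 (src u) (tgt u) (id_flat n)) (lab u).
Proof. exact: (valP u). Qed.

Lemma gen_eqE u w : (u == w) = [&& src u == src w, tgt u == tgt w & lab u == lab w].
Proof.
by case: u => [[[a b] l] lu]; case: w => [[[a' b'] l'] lw]; rewrite -val_eqE /= !xpair_eqE andbA.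
Qed.

Definition plus_gen a b : gen n := exist _ (a, b, [ffun=> false]) (labelling_const a b false).

Definition is_unit u := (src u == tgt u) && (lab u == [ffun=> false]).

Lemma is_unitP u : is_unit u = (u == plus_gen (src u) (src u)).
Proof. by rewrite gen_eqE /is_unit /plus_gen /= eqxx eq_sym. Qed.

Definition unit_comb c : H n := [ffun v => c (src v) * (is_unit v)%:R].

Definition right_factor u : R := (gX * circle_weight (src u) (tgt u) (lab u)) ^+ n.

Lemma double_inj_lab (l l' : {ffun strip n n -> bool}) :
  (Defs.double l == Defs.double l') = (l == l').
Proof.
apply/eqP/eqP => [E | -> //]; apply/ffunP => y.
by have := congr1 (fun h : {ffun strip2 n n n -> bool} => h (inl y)) E; rewrite !ffunE.
Qed.

Lemma mul_coef_unit_l u v w : is_unit u ->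
  mul_coef u v w = ((tgt u == src v) && (w == v))%:R.
Proof.
case/andP => /eqP su /eqP lu; rewrite /mul_coef; case: eqP => [tu | //].
rewrite gen_eqE -tu -su; case: eqP => //= sw; case: eqP => //= tw.
rewrite su tu lu W_saddlesE.
have := F_chron_left (gen_labelling v) 1 (arc_state0 (src v)).
rewrite left_label0 left_weight0 expr1n mul1r /=.
rewrite [X in F_chron _ _ _ _ X = _](_ : _ = [ffun z => (z == glue [ffun=> false] (lab v))%:R]).
  by move=> ->; rewrite ffunE mul1r double_inj_lab.
by apply/ffunP => y; rewrite !ffunE mul1r.
Qed.

Lemma mul_coef_unit_r u v w : is_unit v ->
  mul_coef u v w = ((tgt u == src v) && (w == u))%:R * right_factor u.
Proof.
case/andP => /eqP sv /eqP lv; rewrite /mul_coef; case: eqP => [tu | _]; last by rewrite mul0r.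
rewrite gen_eqE -sv -tu; case: eqP => //= sw; last by rewrite mul0r.
case: eqP => //= tw; last by rewrite mul0r.
rewrite lv W_saddlesE.
have := F_chron_right (gen_labelling u) 1 (arc_state0 (tgt u)).
rewrite mul1r size_right_ends /=.
rewrite [X in F_chron _ _ _ _ X = _](_ : _ = [ffun z => (z == glue (lab u) [ffun=> false])%:R]).
  by move=> ->; rewrite ffunE double_inj_lab mulrC.
apply/ffunP => y; rewrite !ffunE mul1r; congr (y == _)%:R.
by apply/ffunP => -[] k; rewrite !ffunE.
Qed.

Lemma arc_mul_unit_r x c :
  arc_mul x (unit_comb c) = [ffun w => (x w : R) * c (tgt w) * right_factor w].
Proof.
apply/ffunP => w; rewrite !ffunE (bigD1 w) //= [X in _ + X]big1 ?addr0 => [|u uw]; last first.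
  apply: big1 => v _; rewrite ffunE; case uv: (is_unit v); last by rewrite mulr0 mulr0 mul0r.
  by rewrite mul_coef_unit_r // [w == u]eq_sym (negbTE uw) andbF mul0r mulr0.
rewrite (bigD1 (plus_gen (tgt w) (tgt w))) //= big1 ?addr0 => [|v vw].
  have up : is_unit (plus_gen (tgt w) (tgt w)) by rewrite is_unitP.
  by rewrite ffunE up mulr1 mul_coef_unit_r //= !eqxx mul1r.
rewrite ffunE; case uv: (is_unit v); last by rewrite mulr0 mulr0 mul0r.
rewrite mul_coef_unit_r //; case: eqP => [tw|_]; last by rewrite mul0r mulr0.
by move: uv vw; rewrite is_unitP tw => ->.
Qed.

Lemma arc_mul_unit_l x c : arc_mul (unit_comb c) x = [ffun w => c (src w) * (x w : R)].
Proof.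
apply/ffunP => w; rewrite !ffunE (bigD1 (plus_gen (src w) (src w))) //=.
rewrite [X in _ + X]big1 ?addr0 => [|u uw].
  have up : is_unit (plus_gen (src w) (src w)) by rewrite is_unitP.
  rewrite (bigD1 w) //= big1 ?addr0 => [|v vw].
    by rewrite ffunE up mulr1 mul_coef_unit_l //= !eqxx mulr1.
  by rewrite mul_coef_unit_l // [w == v]eq_sym (negbTE vw) andbF mulr0.
apply: big1 => v _; rewrite ffunE; case uv: (is_unit u); last by rewrite mulr0 !mul0r.
rewrite mul_coef_unit_l //; case: eqP => [tu|_]; last by rewrite mulr0.
case: eqP => [wv|_]; last by rewrite mulr0.
have E : src u = src w by case/andP: (uv) => /eqP -> _; rewrite tu wv.
by move: uv uw; rewrite is_unitP E => ->.
Qed.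

Lemma zeta_right_factor u : zeta (a := src u) (b := tgt u) (id_flat n, gen_deg u) = right_factor u.
Proof.
by rewrite /gen_deg zeta_gen /right_factor circle_weightE exprMn exprMn -!exprM ![(_ * n)%N]mulnC.
Qed.

Lemma right_factor_unit u : exists s, right_factor u * s = 1.
Proof.
exists ((gX * \prod_(k | col_max (src u) (tgt u) k == k) vlam false (lab u (inr k))) ^+ n).
rewrite /right_factor /circle_weight -exprMn mulrACA gX2 mul1r -big_split big1 ?expr1n //= => k _.
exact: vlamC.
Qed.

Lemma gen_deg_unit u : is_unit u -> gen_deg u = (n%:Z, 0).
Proof.
rewrite is_unitP => /eqP ->; rewrite /gen_deg.
set l := circles _ _; have lE : size l = n by apply: size_circles_diag.
rewrite (eq_count (a2 := predT)) => [|y]; last by rewrite /lab /= ffunE.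
rewrite count_predT lE (eq_count (a2 := pred0)) => [|y]; last by rewrite /lab /= ffunE.
by rewrite count_pred0.
Qed.

Lemma unit_gen_deg u : src u = tgt u -> gen_deg u = (n%:Z, 0) -> is_unit u.
Proof.
move=> su; rewrite /gen_deg => -[_ h]; rewrite /is_unit su eqxx /=; apply/eqP.
(* The second coordinate of the degree counts the circles labelled v_-, up to sign. *)
apply: (labelling_count0 (gen_labelling u)); move: h; set k := count _ _; lia.
Qed.

Lemma arc_oneE : arc_one n = unit_comb (fun=> 1).
Proof.
apply/ffunP => u; rewrite /arc_one sum_ffunE ffunE mul1r (bigD1 (src u)) //= big1 => [|a au].
  by rewrite ffunE addr0 eqxx /= eq_sym.
by rewrite ffunE eq_sym (negbTE au).
Qed.

Lemma graded_centerP z : graded_center z <-> exists r : R, unit_comb (fun=> r) = z.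
Proof.
split.
  case=> -[f fh zE] zc.
  have zu : z = unit_comb (fun a => z (plus_gen a a)).
    apply/ffunP => u; rewrite ffunE; case uu: (is_unit u).
      by move: uu; rewrite is_unitP mulr1 => /eqP <-.
    rewrite mulr0 zE sum_ffunE big1 // => a _.
    have [// | /eqP /fh [sa ta /(congr1 snd) /= gd]] := eqVneq (f a u) 0.
    by rewrite unit_gen_deg ?sa ?ta // in uu.
  have zeq a b : z (plus_gen a a) = z (plus_gen b b).
    set w := plus_gen a b; pose x : H n := [ffun u => (u == w)%:R].
    have xh : homogeneous (a := a) (b := b) (id_flat n, gen_deg w) x.
      by move=> u; rewrite ffunE; case: eqP => // -> _.
    have := zc _ _ _ _ xh; rewrite {1 2}zu arc_mul_unit_r arc_mul_unit_l.
    move/(congr1 (fun h : H n => h w)); rewrite !ffunE eqxx (zeta_right_factor w) mul1r mulr1.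
    (* [R] has zero divisors, as (X - 1)(X + 1) = 0, so the common factor is cancelled by means of
       its inverse. *)
    rewrite [_ *: _]mulrC => E; have [s ws] := right_factor_unit w.
    have := congr1 (fun y : R => y * s) E.
    by rewrite -!mulrA ws !mulr1 => /esym.
  case: (pickP (fun _ : B n => true)) => [a0 _ | B0].
    exists (z (plus_gen a0 a0)); rewrite [RHS]zu; apply/ffunP => u.
    by rewrite !ffunE (zeq a0 (src u)).
  (* Without any matching [H n] would be zero, and every [r] would do. *)
  by exists 0; apply/ffunP => u; have := B0 (src u).
case=> r <-; split.
  exists (fun a => unit_comb (fun b => r * (b == a)%:R)).
    move=> a u; rewrite ffunE; case uu: (is_unit u); last by rewrite mulr0.
    case: eqP => [sa _|]; last by rewrite mulr0 mul0r.
    have /andP [/eqP su _] := uu.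
    by split; rewrite // -?su // /IdG gen_deg_unit.
  apply/ffunP => u; rewrite sum_ffunE (bigD1 (src u)) //= big1 => [|a au].
    by rewrite !ffunE eqxx mulr1 addr0.
  by rewrite ffunE eq_sym (negbTE au) mulr0 mul0r.
move=> a b g x xh; rewrite arc_mul_unit_r arc_mul_unit_l; apply/ffunP => w.
rewrite !ffunE; have [-> | /eqP xw] := eqVneq (x w) 0; first by rewrite !mul0r mulr0 scaler0.
case: (xh w xw) => sa tb ->; move: (zeta_right_factor w).
case: _ / sa; case: _ / tb => ->.
by rewrite [_ * r]mulrC; apply: mulrC.
Qed.

End ArcAlgebra.

(** * Existence of a crossingless matching *)

Section PairMatching.
Variable n : nat.

Lemma pair_partner_lt (i : 'I_n.*2) : ((if odd i then i.-1 else i.+1) < n.*2)%N.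
Proof. by have := ltn_ord i; case: ifP => oi; lia. Qed.

(** Joins 2k to 2k + 1. A matching makes [H n] nonzero: evaluating at its unit recovers the scalar,
    which gives injectivity. *)
Definition pair_partner : {ffun 'I_n.*2 -> 'I_n.*2} :=
  [ffun i => Ordinal (pair_partner_lt i)].

Lemma pair_partner_crossingless : crossingless (@nat_of_ord _) pair_partner.
Proof.
apply/andP; split; apply/forallP => i.
  rewrite -!val_eqE /= !ffunE /= ?ffunE /= -(odd_double_half i).
  case: (odd i); rewrite ?add1n ?add0n /= !odd_double /= ?odd_double /= ?eqxx ?andbT.
    by rewrite neq_ltn ltnSn.
  by rewrite neq_ltn ltnSn orbT.
apply/forallP => j; rewrite !ffunE /=; apply/negP => /and3P [].
by case: ifP => oi; case: ifP => oj; lia.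
Qed.

Definition pair_matching : B n := exist _ pair_partner pair_partner_crossingless.

End PairMatching.

Unset Implicit Arguments.

Theorem proposition6p1 (n : nat) (hn : (1 <= n)%N) :
  exists phi : R -> H n,
    [/\ [/\ (forall r s : R, phi (r + s) = phi r + phi s),
            (forall r s : R, phi (r * s) = arc_mul (phi r) (phi s)),
            phi 1 = arc_one n
          & injective phi],
        (forall z : H n, graded_center z <-> exists r : R, phi r = z)
      & (forall z : H n, graded_center_inv z <-> exists2 r : R, R_unit r & phi r = z)].
Proof.
have mulE r s : arc_mul (unit_comb (n := n) (fun=> r)) (unit_comb (fun=> s)) = unit_comb (fun=> r * s).
  by rewrite arc_mul_unit_l; apply/ffunP => u; rewrite !ffunE mulrA.
have inj : injective (fun r : R => unit_comb (n := n) (fun=> r)).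
  move=> r s /(congr1 (fun h : H n => h (plus_gen (pair_matching n) (pair_matching n)))).
  by rewrite !ffunE /is_unit !eqxx !mulr1.
exists (fun r => unit_comb (fun=> r)); split; first split.
- by move=> r s; apply/ffunP => u; rewrite !ffunE mulrDl.
- by move=> r s; rewrite mulE.
- by rewrite arc_oneE.
- exact: inj.
- exact: graded_centerP.
move=> z; split.
  case=> /graded_centerP [r <-] [z' /graded_centerP [s <-]].
  by rewrite mulE arc_oneE => /inj rs; exists r => //; exists s.
case=> r [s rs] <-; split; first by apply/graded_centerP; exists r.
exists (unit_comb (fun=> s)); first by apply/graded_centerP; exists s.
by rewrite mulE rs arc_oneE.
Qed.
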